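(* There exists a computationally efficient algorithm with the following guarantees. Given as input (i) a DAG $\mathcal{S}$ with $n$ nodes and maximum in-degree $d$ and a known $(c,C)$-balanced Bayes net $Q$ with structure $\mathcal{S}$, where $c=\widetilde\Omega(1/\sqrt n)$ and $C=\widetilde\Omega(d\epsilon^2/\sqrt n)$; (ii) a parameter $\epsilon>0$; and (iii) sample access to an unknown Bayes net $P$ with structure $\mathcal{S}$, the algorithm takes $O(2^{d/2}\sqrt n/\epsilon^2)$ samples from $P$ and distinguishes with probability at least $2/3$ between the cases $P=Q$ and $\|P-Q\|_1>\epsilon$.
   Context: Let $\mathcal{S}$ be a DAG on $[n]$, topologically sorted (all edges go from smaller to larger labels), and let $\Pi(i)$ be the parent set of $i$. A distribution $P$ on $\{0,1\}^n$ is a Bayes net with structure $\mathcal{S}$ if for each $i$, $\Pr_{X\sim P}[X_i=1\mid X_1,\dots,X_{i-1}]$ depends only on $X_{\Pi(i)}$. For $i\in[n]$ and $a\in\{0,1\}^{|\Pi(i)|}$, the parental configuration $\Pi_{i,a}$ is the event $X_{\Pi(i)}=a$, and $p_{i,a}=\Pr_{X\sim P}[X_i=1\mid\Pi_{i,a}]$. $P$ is $(c,C)$-balanced if for all such $(i,a)$: $p_{i,a}\in[c,1-c]$ and $\Pr_P[\Pi_{i,a}]\ge C$. $\|P-Q\|_1=\sum_x|P(x)-Q(x)|$. $\widetilde\Omega$ hides logarithmic factors. *)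

(* Defs.v *)
From mathcomp Require Import all_boot all_order all_algebra.
From mathcomp Require Import reals exp.
Set Implicit Arguments.
Unset Strict Implicit.
Unset Printing Implicit Defensive.
Import Order.TTheory GRing.Theory Num.Theory.
Local Open Scope ring_scope.

Definition cube (n : nat) := {ffun 'I_n -> bool}.

Section Dag.
Variables (n : nat) (S : rel 'I_n).

(* [S j i] is the edge j -> i; a topologically sorted relation is acyclic. *)
Definition topsorted := forall j i : 'I_n, S j i -> (j < i)%N.

Definition parents (i : 'I_n) : {set 'I_n} := [set j | S j i].

Definition max_indegree : nat := \max_(i < n) #|parents i|.

(* The value x_{Pi(i)}, parents being listed in increasing order. *)
Definition parent_values (i : 'I_n) (x : cube n) : bitseq :=
  [seq x j | j <- enum (parents i)].

End Dag.

Section Distributions.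
Variables (R : realType) (n : nat).
Implicit Types (P Q : cube n -> R) (E F : pred (cube n)) (S : rel 'I_n).

Definition is_distribution P :=
  (forall x, 0 <= P x) /\ \sum_x P x = 1.

Definition Pr P E : R := \sum_(x | E x) P x.

(* Equal to 0 when [Pr P F = 0]. *)
Definition condPr P E F : R := Pr P [predI E & F] / Pr P F.

Definition same_prefix (i : 'I_n) (x : cube n) : pred (cube n) :=
  fun y => [forall j : 'I_n, (j < i)%N ==> (y j == x j)].

Definition coord_true (i : 'I_n) : pred (cube n) := fun y => y i.

(* The conditional probability given a prefix is only constrained on prefixes
   of positive probability, where it is defined. *)
Definition bayes_net S P :=
  is_distribution P /\
  forall (i : 'I_n) (x y : cube n),
    0 < Pr P (same_prefix i x) -> 0 < Pr P (same_prefix i y) ->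
    parent_values S i x = parent_values S i y ->
    condPr P (coord_true i) (same_prefix i x) =
    condPr P (coord_true i) (same_prefix i y).

Definition parent_config S (i : 'I_n) (a : bitseq) : pred (cube n) :=
  fun x => parent_values S i x == a.

Definition cond_param S P (i : 'I_n) (a : bitseq) : R :=
  condPr P (coord_true i) (parent_config S i a).

Definition balanced S (c C : R) P :=
  forall (i : 'I_n) (a : #|parents S i|.-tuple bool),
    c <= cond_param S P i a <= 1 - c /\ C <= Pr P (parent_config S i a).

Definition l1_dist P Q : R := \sum_x `|P x - Q x|.

End Distributions.

(* Randomized algorithms: programs of a real RAM with uniform cost. A program
   has finitely many arrays of natural numbers and of real numbers, each array
   being designated by a constant. Natural numbers are only added and
   subtracted, so that t steps produce numbers of O(t) bits more than the
   input; real numbers support field operations and comparisons, but no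
   rounding to a natural number and no constants other than natural numbers. *)
Inductive nexp :=
| NConst of nat
| NLoad of nat & nexp
| NAdd of nexp & nexp
| NSub of nexp & nexp.

Inductive rexp :=
| RNat of nexp
| RLoad of nat & nexp
| RAdd of rexp & rexp
| RSub of rexp & rexp
| RMul of rexp & rexp
| RDiv of rexp & rexp.

Inductive bexp :=
| BLeN of nexp & nexp
| BLeR of rexp & rexp
| BNot of bexp
| BAnd of bexp & bexp.

(* [Draw X e] takes a fresh sample and writes its bits in array X from index e
   on; [Flip X e] writes a fresh fair coin at index e of array X. *)
Inductive cmd :=
| Skip
| NStore of nat & nexp & nexp
| RStore of nat & nexp & rexp
| Draw of nat & nexp
| Flip of nat & nexp
| Seq of cmd & cmd
| If of bexp & cmd & cmd
| While of bexp & cmd.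

Section Semantics.
Variable R : realType.

Record state := State {
  nmem : nat -> nat -> nat;
  rmem : nat -> nat -> R;
  drawn : nat;
  flipped : nat
}.

Fixpoint neval (s : state) (e : nexp) : nat :=
  match e with
  | NConst k => k
  | NLoad X e1 => nmem s X (neval s e1)
  | NAdd e1 e2 => (neval s e1 + neval s e2)%N
  | NSub e1 e2 => (neval s e1 - neval s e2)%N
  end.

Fixpoint reval (s : state) (e : rexp) : R :=
  match e with
  | RNat e1 => (neval s e1)%:R
  | RLoad X e1 => rmem s X (neval s e1)
  | RAdd e1 e2 => reval s e1 + reval s e2
  | RSub e1 e2 => reval s e1 - reval s e2
  | RMul e1 e2 => reval s e1 * reval s e2
  | RDiv e1 e2 => reval s e1 / reval s e2
  end.

Fixpoint beval (s : state) (b : bexp) : bool :=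
  match b with
  | BLeN e1 e2 => (neval s e1 <= neval s e2)%N
  | BLeR e1 e2 => reval s e1 <= reval s e2
  | BNot b1 => ~~ beval s b1
  | BAnd b1 b2 => beval s b1 && beval s b2
  end.

Definition update (T : Type) (M : nat -> nat -> T) (X i : nat) (v : T) :=
  fun Y j : nat => if (Y == X) && (j == i) then v else M Y j.

Definition write_bits (M : nat -> nat -> nat) (X i : nat) (v : bitseq) :=
  fun Y j : nat =>
    if (Y == X) && (i <= j < i + size v)%N then nat_of_bool (nth false v (j - i))
    else M Y j.

(* [smp] and [coin] are the streams of samples and of coin flips. The first
   component of a configuration is the stack of commands left to execute. *)
Definition step (smp : nat -> bitseq) (coin : nat -> bool)
    (cf : seq cmd * state) : seq cmd * state :=
  let: (ks, s) := cf in
  if ks isn't c :: k then cf else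
  match c with
  | Skip => (k, s)
  | NStore X e v =>
      (k, State (update (nmem s) X (neval s e) (neval s v)) (rmem s)
            (drawn s) (flipped s))
  | RStore X e v =>
      (k, State (nmem s) (update (rmem s) X (neval s e) (reval s v))
            (drawn s) (flipped s))
  | Draw X e =>
      (k, State (write_bits (nmem s) X (neval s e) (smp (drawn s))) (rmem s)
            (drawn s).+1 (flipped s))
  | Flip X e =>
      (k, State
            (update (nmem s) X (neval s e) (nat_of_bool (coin (flipped s))))
            (rmem s) (drawn s) (flipped s).+1)
  | Seq c1 c2 => (c1 :: c2 :: k, s)
  | If b c1 c2 => ((if beval s b then c1 else c2) :: k, s)
  | While b c1 => (if beval s b then c1 :: c :: k else k, s)
  end.

Record input := Input { nat_input : seq (seq nat); real_input : seq (seq R) }.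

Definition input_size (inp : input) : nat :=
  (sumn (shape (nat_input inp)) + sumn (shape (real_input inp)))%N.

(* The X-th input sequence is stored in array X; other cells contain 0. *)
Definition init (inp : input) : state :=
  State (fun X j => nth 0%N (nth [::] (nat_input inp) X) j)
        (fun X j => nth 0 (nth [::] (real_input inp) X) j) 0 0.

Definition run (prog : cmd) (inp : input) (smp : nat -> bitseq)
    (coin : nat -> bool) (t : nat) : seq cmd * state :=
  iter t (step smp coin) ([:: prog], init inp).

(* The answer is read in cell 0 of the natural-number array 2. *)
Definition accepts (prog : cmd) (inp : input) (smp : nat -> bitseq)
    (coin : nat -> bool) (t : nat) : bool :=
  nmem (run prog inp smp coin t).2 2 0 != 0%N.

End Semantics.

Section Testing.
Variables (R : realType) (n : nat).

Definition sample_bits (x : cube n) : bitseq := [seq x j | j <- enum 'I_n].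

(* Worst case over all sequences of samples and coin flips. *)
Definition halts_within (prog : cmd) (inp : input R) (m t : nat) :=
  forall (smp : nat -> cube n) (coin : nat -> bool),
    let: (ks, s) := run prog inp (fun j => sample_bits (smp j)) coin t in
    ks = [::] /\ (drawn s <= m)%N.

Definition stream (T : Type) (t0 : T) (m : nat) (w : 'I_m -> T) : nat -> T :=
  fun j => if insub j is Some i then w i else t0.

(* Probability that a program halting within t steps and m draws answers [b],
   over m independent samples from P and t independent fair coins. *)
Definition answer_prob (prog : cmd) (inp : input R) (P : cube n -> R)
    (m t : nat) (b : bool) : R :=
  \sum_(w : {ffun 'I_m -> cube n}) \sum_(r : {ffun 'I_t -> bool})
    (\prod_(j < m) P (w j)) * 2 ^- t *
    (accepts prog inp (stream [::] (fun j => sample_bits (w j)))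
       (stream false r) t == b)%:R.

(* All bit sequences of length k, in lexicographic order. *)
Fixpoint all_bits (k : nat) : seq bitseq :=
  if k is k'.+1 then
    map (cons false) (all_bits k') ++ map (cons true) (all_bits k')
  else [:: [::]].

(* Natural-number arrays: n, and the adjacency matrix of S, row j listing the
   edges out of j. Real arrays: eps, and the tables of the parameters q_{i,a}
   for the successive nodes i. *)
Definition tester_input (S : rel 'I_n) (Q : cube n -> R) (eps : R) : input R :=
  Input
    [:: [:: n];
        flatten [seq [seq nat_of_bool (S j i) | i <- enum 'I_n]
                | j <- enum 'I_n]]
    [:: [:: eps];
        flatten [seq [seq cond_param S Q i a | a <- all_bits #|parents S i|]
                | i <- enum 'I_n]].

Definition sample_scale (S : rel 'I_n) (eps : R) : R :=
  2 `^ ((max_indegree S)%:R / 2) * Num.sqrt n%:R / eps ^+ 2.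

End Testing.

(* The factor A log^k hidden in Omega-tilde. *)
Definition log_factor (R : realType) (A : R) (k n : nat) : R :=
  A * (1 + ln n%:R) ^+ k.

(* Main.v *)
Require Import Defs.
From mathcomp Require Import all_boot all_order all_algebra.
From mathcomp Require Import reals sequences exp.
From mathcomp Require Import ring lra zify.
Set Implicit Arguments.
Unset Strict Implicit.
Unset Printing Implicit Defensive.
Import Order.TTheory GRing.Theory Num.Theory.
Local Open Scope ring_scope.

(* Call g = (i, a) a configuration; a sample hits g when its parents of i take
   the value a. Let D be the number of configurations and q_g the given
   parameters of Q.

   The tester draws m samples, m being about sqrt D / eps^2, and counts the
   hits N_g of each g. It then draws 3 m samples and looks at the bits x_i of
   the first N_g samples which hit g. It rejects if some N_g is below a
   logarithmic threshold or if the second batch hits some g less than N_g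
   times; otherwise it accepts iff the sum over g of

     sum_(k <> l) (y_k - q_g) (y_l - q_g) / (N_g q_g (1 - q_g))

   is at most m eps^2 / 64, where y_1, ..., y_(N_g) are the bits read at g.
   Conditionally on the N_g, the bits read can be taken from independent tapes
   of Bernoulli(p_g) variables: for any nonnegative function, its expectation on
   the event that no g runs out of samples is at most its expectation for
   independent tapes. The statistic thus has mean sum_g (N_g - 1) chi2(p_g, q_g)
   and its variance is computed exactly for independent bits. If P = Q, the
   mean is 0 and the variance at most 4 D. If P is far from Q, then N_g is at
   least m Pr_P[g] / 4 with high probability for all g unless the tester
   rejects, and the mean is at least m eps^2 / 32, since
   |P - Q|_1^2 <= 4 sum_g Pr_P[g] chi2(p_g, q_g). *)

(** * Expectation over independent samples *)

(** The obstacle is that the bits read at a node decide which configurations are hit at later nodes,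
    so the number of bits available at [g] is random and correlated with other bits. Taking the
    [N_g] from a separate batch freezes them, and truncating at [N_g] bits leaves tapes of fixed
    length; this plays the role of Poissonization while the number of draws stays fixed. Truncation
    yields only an inequality for nonnegative functions, which is what Chebyshev requires.
    Balancedness concerns [Q], while [P] may have arbitrarily rare configurations; the rejection
    threshold deals with these. The bound on [C] makes the expected hits under [Q] exceed a
    logarithm of D. The bound on [c] keeps [1 / (q_g (1 - q_g))] below [sqrt D / 1000], which
    controls the part of the variance caused by [p_g <> q_g]. A node with at most d parents has at
    most [2 ^ d] configurations, hence [D <= n 2 ^ d], and [sqrt D / eps^2] has the announced
    order. *)

Section IidExpectation.
Variables (R : realType) (T : finType).
Implicit Types (mu : T -> R) (f g : seq T -> R).

(** The weight [mu] may have any total mass: with the constant weight 1 this is plain summation over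
    lists of length [m], which lets [iidE_density] move a density into the integrand. *)
Fixpoint iidE mu (m : nat) f : R :=
  if m is k.+1 then \sum_x mu x * iidE mu k (fun s => f (x :: s)) else f [::].

Lemma eq_iidE mu m f g :
  (forall s, size s = m -> f s = g s) -> iidE mu m f = iidE mu m g.
Proof.
elim: m f g => [|m IH] f g fg /=; first exact: fg.
by apply: eq_bigr => x _; congr (_ * _); apply: IH => s sm; apply: fg; rewrite /= sm.
Qed.

Lemma iidED mu m f g :
  iidE mu m (fun s => f s + g s) = iidE mu m f + iidE mu m g.
Proof.
elim: m f g => [//|m IH] f g /=; rewrite -big_split /=.
by apply: eq_bigr => x _; rewrite IH mulrDr.
Qed.

Lemma iidEZ mu m a f : iidE mu m (fun s => a * f s) = a * iidE mu m f.
Proof.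
elim: m f => [//|m IH] f /=; rewrite mulr_sumr.
by apply: eq_bigr => x _; rewrite IH mulrCA.
Qed.

Lemma iidE0 mu m : iidE mu m (fun=> 0) = 0.
Proof. by have := iidEZ mu m 0 (fun=> 0); rewrite !mul0r. Qed.

Lemma iidE_sum mu m (I : Type) (r : seq I) (F : I -> seq T -> R) :
  iidE mu m (fun s => \sum_(i <- r) F i s) = \sum_(i <- r) iidE mu m (F i).
Proof.
elim: r => [|i r IH].
  by rewrite big_nil -[RHS](iidE0 mu m); apply: eq_iidE => s _; rewrite big_nil.
rewrite big_cons -IH -iidED; apply: eq_iidE => s _; exact: big_cons.
Qed.

Lemma iidE_cst mu m a : \sum_x mu x = 1 -> iidE mu m (fun=> a) = a.
Proof.
by move=> mu1; elim: m => [//|m IH] /=; rewrite IH -mulr_suml mu1 mul1r.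
Qed.

Lemma ler_iidE mu m f g : (forall x, 0 <= mu x) ->
  (forall s, size s = m -> f s <= g s) -> iidE mu m f <= iidE mu m g.
Proof.
move=> mu0; elim: m f g => [|m IH] f g fg /=; first exact: fg.
apply: ler_sum => x _; apply: ler_wpM2l => //; apply: IH => s sm.
by apply: fg; rewrite /= sm.
Qed.

Lemma iidE_ge0 mu m f : (forall x, 0 <= mu x) ->
  (forall s, size s = m -> 0 <= f s) -> 0 <= iidE mu m f.
Proof. by move=> mu0 f0; rewrite -(iidE0 mu m); apply: ler_iidE. Qed.

Lemma iidE_cat mu m m' f :
  iidE mu (m + m') f = iidE mu m (fun s => iidE mu m' (fun s' => f (s ++ s'))).
Proof.
elim: m f => [|m IH] f //=.
by apply: eq_bigr => x _; rewrite IH.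
Qed.

Lemma iidE_prod mu m (h : T -> R) :
  iidE mu m (fun s => \prod_(x <- s) h x) = (\sum_x mu x * h x) ^+ m.
Proof.
elim: m => [|m IH] /=; first by rewrite big_nil.
rewrite exprS -IH mulr_suml; apply: eq_bigr => x _.
rewrite -mulrA; congr (_ * _); rewrite -iidEZ.
apply: eq_iidE => s _; exact: big_cons.
Qed.

Lemma iidE_density mu m f :
  iidE mu m f = iidE (fun=> 1) m (fun s => (\prod_(x <- s) mu x) * f s).
Proof.
elim: m f => [|m IH] f /=; first by rewrite big_nil mul1r.
apply: eq_bigr => x _; rewrite mul1r IH -iidEZ; apply: eq_iidE => s _.
by rewrite big_cons mulrA.
Qed.

Lemma sum_ffunS (V : nmodType) m (F : {ffun 'I_m.+1 -> T} -> V) :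
  \sum_w F w =
  \sum_x \sum_(w : {ffun 'I_m -> T})
    F [ffun j => if unlift ord0 j is Some k then w k else x].
Proof.
rewrite pair_big /=.
rewrite (reindex (fun p : T * {ffun 'I_m -> T} =>
  [ffun j => if unlift ord0 j is Some k then p.2 k else p.1])) //=.
exists (fun w : {ffun 'I_m.+1 -> T} => (w ord0, [ffun k => w (lift ord0 k)])).
  case=> x w _ /=; rewrite ffunE unlift_none; congr (_, _).
  by apply/ffunP => k; rewrite !ffunE liftK.
move=> w _; apply/ffunP => j; rewrite ffunE /=.
by case: unliftP => [k|] -> //; rewrite ffunE.
Qed.

(** Bridge to the sums over finite functions in [answer_prob]. *)
Lemma iidE_ffun mu m f :
  \sum_(w : {ffun 'I_m -> T}) (\prod_(j < m) mu (w j)) * f (codom w)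
  = iidE mu m f.
Proof.
elim: m f => [|m IH] f /=.
  rewrite (eq_bigr (fun=> f [::])) => [|w _].
    by rewrite sumr_const card_ffun card_ord expn0.
  rewrite big_ord0 mul1r; congr f; apply/size0nil.
  by rewrite size_codom card_ord.
rewrite sum_ffunS; apply: eq_bigr => x _; rewrite -IH mulr_sumr.
apply: eq_bigr => w _; rewrite big_ord_recl ffunE unlift_none -mulrA.
congr (_ * (_ * f _)).
  by apply: eq_bigr => j _; rewrite ffunE liftK.
rewrite /codom /image_mem enum_ordSl /= ffunE unlift_none; congr (_ :: _).
by rewrite -map_comp; apply: eq_map => j /=; rewrite ffunE liftK.
Qed.

End IidExpectation.

Arguments eq_iidE {R T mu m f g}.

Lemma exchange_iidE (R : realType) (T U : finType) (mu : T -> R) (nu : U -> R)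
    m k (f : seq T -> seq U -> R) :
  iidE mu m (fun s => iidE nu k (f s)) =
  iidE nu k (fun t => iidE mu m (fun s => f s t)).
Proof.
elim: m f => [|m IH] f //=; rewrite iidE_sum.
by apply: eq_bigr => x _; rewrite iidEZ IH.
Qed.

(** * Tapes of configurations *)

Definition bern (R : realType) (p : R) (b : bool) : R := if b then p else 1 - p.

Lemma bern_ge0 (R : realType) (p : R) b : 0 <= p <= 1 -> 0 <= bern p b.
Proof. by case/andP=> p0 p1; case: b; rewrite /bern ?subr_ge0. Qed.

Lemma sum_bern (R : realType) (p : R) : \sum_b bern p b = 1.
Proof. by rewrite big_bool /bern /=; ring. Qed.

Definition flip n (k : 'I_n) (x : cube n) : cube n :=
  [ffun j => if j == k then ~~ x j else x j].

Lemma flipK n (k : 'I_n) : involutive (flip k).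
Proof. by move=> x; apply/ffunP => j; rewrite !ffunE; case: eqP => // _; rewrite negbK. Qed.

Section ConfigSystem.
Variables (R : realType) (n : nat) (G : finType).
Variables (pos : 'I_n -> cube n -> G) (owner : G -> 'I_n).
Hypothesis owner_pos : forall i x, owner (pos i x) = i.
Hypothesis pos_prefix : forall (i : 'I_n) (x y : cube n),
  (forall j : 'I_n, (j < i)%N -> x j = y j) -> pos i x = pos i y.

(** The configuration of a node depends on earlier coordinates only. Starting from uniform bits, the
    kernels are put back one node at a time. Flipping coordinate [k] changes neither the kernels of
    earlier nodes nor the constants [1/2] of later ones, so pairing [x] with its flip sums the
    kernel of node [k] to 1. *)
Lemma sum_kernel (r : G -> bool -> R) : (forall g, \sum_b r g b = 1) ->
  \sum_x \prod_(i < n) r (pos i x) (x i) = 1.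
Proof.
move=> r1.
pose h k (i : 'I_n) (x : cube n) := if (i < k)%N then r (pos i x) (x i) else 2^-1.
suff A k : (k <= n)%N -> \sum_(x : cube n) \prod_(i < n) h k i x = 1.
  rewrite -[RHS](A n (leqnn n)); apply: eq_bigr => x _; apply: eq_bigr => i _.
  by rewrite /h ltn_ord.
elim: k => [_|k IH kn].
  rewrite (eq_bigr (fun=> 2^-1 ^+ n)) => [|x _]; last first.
    by rewrite /h prodr_const card_ord.
  rewrite sumr_const card_ffun card_bool card_ord -[_ *+ _]mulr_natr natrX.
  by rewrite -exprMn mulVf ?expr1n // pnatr_eq0.
rewrite -[RHS](IH (ltnW kn)).
pose i0 := Ordinal kn.
pose H (x : cube n) := \prod_(i < n | i != i0) h k i x.
have hH x : \prod_(i < n | i != i0) h k.+1 i x = H x.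
  apply: eq_bigr => i; rewrite /h ltnS leq_eqVlt => ne.
  by rewrite -(inj_eq val_inj) /= in ne; rewrite (negbTE ne).
have Hflip x : H (flip i0 x) = H x.
  apply: eq_bigr => i ne; rewrite /h; case: ifP => // ik.
  have -> : pos i (flip i0 x) = pos i x.
    apply: pos_prefix => j ji; rewrite ffunE -(inj_eq val_inj) /=.
    by rewrite ltn_eqF // (ltn_trans ji).
  by rewrite ffunE (negbTE ne).
have posflip x : pos i0 (flip i0 x) = pos i0 x.
  apply: pos_prefix => j ji; rewrite ffunE -(inj_eq val_inj) /=.
  by rewrite ltn_eqF.
have E1 : \sum_(x : cube n) \prod_(i < n) h k.+1 i x =
          \sum_(x : cube n) r (pos i0 x) (x i0) * H x.
  apply: eq_bigr => x _; rewrite (bigD1 i0) //= hH {1}/h /= ltnSn //.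
have E2 : \sum_(x : cube n) r (pos i0 x) (x i0) * H x =
          \sum_(x : cube n) r (pos i0 x) (~~ x i0) * H x.
  rewrite (reindex_inj (can_inj (flipK i0))); apply: eq_bigr => x _.
  by rewrite Hflip posflip ffunE eqxx.
have E3 : \sum_(x : cube n) r (pos i0 x) (x i0) * H x +
          \sum_(x : cube n) r (pos i0 x) (~~ x i0) * H x = \sum_x H x.
  rewrite -big_split /=; apply: eq_bigr => x _; rewrite -mulrDl.
  have := r1 (pos i0 x); rewrite big_bool.
  by case: (x i0) => /= e; rewrite ?[r _ false + _]addrC e mul1r.
have E4 : \sum_(x : cube n) \prod_(i < n) h k i x = 2^-1 * \sum_x H x.
  rewrite mulr_sumr; apply: eq_bigr => x _.
  by rewrite (bigD1 i0) //= {1}/h /= ltnn.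
rewrite E4 -E3 -E2 E1; lra.
Qed.

Definition hit (g : G) (x : cube n) := pos (owner g) x == g.
Definition hit_bit (g : G) (x : cube n) := x (owner g).

(** The nodes are in bijection with the configurations hit by [x], with inverse [owner]. *)
Lemma prod_hit (F : G -> R) x :
  \prod_i F (pos i x) = \prod_(g | hit g x) F g.
Proof.
rewrite (reindex_onto (pos^~ x) owner) => [|g /eqP //].
apply: eq_bigl => i; by rewrite /hit owner_pos !eqxx.
Qed.

Definition tape g (ws : seq (cube n)) : bitseq :=
  [seq hit_bit g x | x <- ws & hit g x].

Definition weight (p : R) (s : bitseq) := \prod_(b <- s) bern p b.

Lemma weight_ge0 p s : 0 <= p <= 1 -> 0 <= weight p s.
Proof. by move=> p01; apply: prodr_ge0 => b _; exact: bern_ge0. Qed.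

Definition factorizes (P : cube n -> R) (p : G -> R) :=
  (forall g, 0 <= p g <= 1) /\
  (forall x, P x = \prod_(i < n) bern (p (pos i x)) (x i)).

Variables (P : cube n -> R) (p : G -> R).
Hypothesis PF : factorizes P p.

Lemma factorizes_ge0 x : 0 <= P x.
Proof. by case: PF => p01 ->; apply: prodr_ge0 => i _; exact: bern_ge0. Qed.

Lemma factorizes_sum : \sum_x P x = 1.
Proof.
case: PF => p01 PE; under eq_bigr do rewrite PE.
exact: (sum_kernel (r := fun g => bern (p g)) (fun g => sum_bern (p g))).
Qed.

(* Reading a prescribed bit costs its Bernoulli weight; the conditional law of
   a sample given the prescribed bits is again a product of kernels, so that
   the remaining factor sums to 1. *)
Lemma tape_prefix_le m (L : G -> bitseq) :
  iidE P m (fun ws => \prod_g (prefix (L g) (tape g ws))%:R)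
  <= \prod_g weight (p g) (L g).
Proof.
case: PF => p01 PE.
elim: m L => [|m IH] L /=.
  apply: ler_prod => g _; rewrite ler0n /=.
  by case: (L g) => [|b s] /=; rewrite ?weight_ge0 // /weight big_nil.
pose comp g x := hit g x ==> (if L g is b :: _ then b == hit_bit g x else true).
pose L' x g := if hit g x then behead (L g) else L g.
have step x ws :
    \prod_g (prefix (L g) (tape g (x :: ws)))%:R =
    (\prod_g (comp g x)%:R) * \prod_g (prefix (L' x g) (tape g ws))%:R :> R.
  rewrite -big_split /=; apply: eq_bigr => g _; rewrite -natrM mulnb; congr (nat_of_bool _)%:R.
  rewrite /tape /= /comp /L'; case: ifP => //= _.
  by case: (L g) => [|b s] //=; rewrite prefix0s.
pose r g b := if L g is b' :: _ then (b' == b)%:R else bern (p g) b : R.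
have r1 g : \sum_b r g b = 1.
  rewrite /r; case: (L g) => [|b s]; first exact: sum_bern.
  by rewrite big_bool; case: b; rewrite /= ?addr0 ?add0r.
apply: (@le_trans _ _ (\sum_x P x *
    ((\prod_g (comp g x)%:R) * \prod_g weight (p g) (L' x g)))).
  apply: ler_sum => x _; apply: ler_wpM2l; first exact: factorizes_ge0.
  rewrite (eq_iidE (g := fun ws => (\prod_g (comp g x)%:R) *
    \prod_g (prefix (L' x g) (tape g ws))%:R)) => [|ws _]; last exact: step.
  rewrite iidEZ; apply: ler_wpM2l; last exact: IH.
  by apply: prodr_ge0 => g _; rewrite ler0n.
rewrite le_eqVlt; apply/orP; left; apply/eqP.
(* Once 1 is written as the sum of the products of the kernels [r], both sides agree for each [x],
   and even configuration by configuration. *)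
rewrite -[RHS]mulr1 -[X in _ = _ * X](sum_kernel r1) mulr_sumr; apply: eq_bigr => x _.
rewrite PE.
have aux (F : G -> bool -> R) : \prod_(i < n) F (pos i x) (x i) =
    \prod_g (if hit g x then F g (hit_bit g x) else 1).
  rewrite -big_mkcond -(prod_hit (fun g => F g (hit_bit g x))).
  by apply: eq_bigr => i _; rewrite /hit_bit owner_pos.
rewrite (aux (fun g b => bern (p g) b)) (aux r) -[RHS]big_split /=.
rewrite -[X in _ * X = _]big_split -big_split /=.
apply: eq_bigr => g _; rewrite /comp /L' /r; case: ifP => /= _; last by rewrite !mul1r mulr1.
case: (L g) => [|b s] /=; first by rewrite mul1r mulrC.
by rewrite /weight big_cons; case: eqP => [->|]; rewrite ?mulr1 ?mul1r ?mulr0 ?mul0r ?mulr0.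
Qed.

Variables (N : G -> nat) (Z : G -> bitseq -> R).

(* Expectation of [phi (a + \sum_g Z g y_g)] for independent tapes y_g of
   N g Bernoulli bits. *)
Fixpoint tapeE (phi : R -> R) (gs : seq G) (a : R) : R :=
  if gs is g :: gs' then
    iidE (bern (p g)) (N g) (fun y => tapeE phi gs' (a + Z g y))
  else phi a.

(** Among all candidates of length [k] only the true prefix survives; this reduces functions of
    truncated tapes to the events of [tape_prefix_le]. *)
Lemma sum_prefix k (t : bitseq) (f : bitseq -> R) :
  (k <= size t)%:R * f (take k t) =
  iidE (fun=> 1) k (fun y => (prefix y t)%:R * f y).
Proof.
elim: k t f => [|k IH] t f /=; first by rewrite take0 prefix0s.
case: t => [|b t] /=.
  by rewrite mul0r big1 // => c _; rewrite (eq_iidE (g := fun=> 0)) ?iidE0 ?mulr0 // => s _; rewrite mul0r.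
rewrite ltnS (IH t (fun y => f (b :: y))) big_bool /= !mul1r.
have z : iidE (fun=> 1) k (fun s : bitseq => 0 * f (~~ b :: s)) = 0.
  by rewrite iidEZ mul0r.
by case: b z => /= ->; rewrite ?addr0 ?add0r.
Qed.

(** Tapes outside [gs] have prescribed prefixes [L], those in [gs] are still integrated. The base
    case is [tape_prefix_le]; the inductive step sums over the possible first bits [y] at [g] and
    prescribes them. *)
Lemma tape_le phi m (gs : seq G) (L : G -> bitseq) a :
  (forall t, 0 <= phi t) -> uniq gs ->
  iidE P m (fun ws =>
    (\prod_(g | g \notin gs) (prefix (L g) (tape g ws))%:R) *
    ((\prod_(g <- gs) (N g <= size (tape g ws))%:R) *
     phi (a + \sum_(g <- gs) Z g (take (N g) (tape g ws)))))
  <= (\prod_(g | g \notin gs) weight (p g) (L g)) * tapeE phi gs a.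
Proof.
move=> phi0; have [p01 PE] := PF.
elim: gs L a => [|g gs IH] L a /=.
  move=> _; rewrite (eq_iidE (g := fun ws =>
    phi a * \prod_g (prefix (L g) (tape g ws))%:R)) => [|ws _]; last first.
    by rewrite !big_nil addr0 mul1r mulrC.
  by rewrite iidEZ [leRHS]mulrC; apply: ler_wpM2l => //; exact: tape_prefix_le.
case/andP=> ggs ugs.
pose Ly y h := if h == g then y else L h.
have split (F : G -> bitseq -> R) y : \prod_(h | h \notin gs) F h (Ly y h) =
    F g y * \prod_(h | h \notin g :: gs) F h (L h).
  rewrite (bigD1 g) //= {1}/Ly eqxx; congr (_ * _).
  rewrite (eq_bigl (fun h => h \notin g :: gs)) => [|h]; last first.
    by rewrite inE negb_or andbC.
  by apply: eq_bigr => h; rewrite inE negb_or /Ly => /andP[/negbTE->].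
rewrite (iidE_density (bern (p g))) -iidEZ.
rewrite (eq_iidE (g := fun ws => iidE (fun=> 1) (N g) (fun y =>
  (\prod_(h | h \notin gs) (prefix (Ly y h) (tape h ws))%:R) *
    ((\prod_(h <- gs) (N h <= size (tape h ws))%:R) *
     phi (a + Z g y + \sum_(h <- gs) Z h (take (N h) (tape h ws))))))) => [|ws _].
  rewrite exchange_iidE; apply: ler_iidE => // y _.
  rewrite mulrA [X in _ <= X * _](_ : _ = \prod_(h | h \notin gs) weight (p h) (Ly y h)).
    exact: IH.
  by rewrite (split (fun h => weight (p h))) mulrC.
rewrite !big_cons.
set c1 := \prod_(h | _) _; set c2 := \prod_(h <- gs) _; set c3 := \sum_(h <- gs) _.
rewrite (_ : _ * _ = (N g <= size (tape g ws))%:R *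
  (c1 * (c2 * phi (a + Z g (take (N g) (tape g ws)) + c3)))); last by rewrite !addrA; ring.
rewrite (sum_prefix _ _ (fun y => c1 * (c2 * phi (a + Z g y + c3)))).
apply: eq_iidE => y _.
by rewrite (split (fun h y => (prefix y (tape h ws))%:R)) !mulrA.
Qed.

Lemma tape_le_enum phi m :
  (forall t, 0 <= phi t) ->
  iidE P m (fun ws =>
    (\prod_g (N g <= size (tape g ws))%:R) *
     phi (\sum_g Z g (take (N g) (tape g ws))))
  <= tapeE phi (index_enum G) 0.
Proof.
move=> phi0.
have := @tape_le phi m (index_enum G) (fun=> [::]) 0 phi0 (index_enum_uniq G).
rewrite [X in _ <= X * _]big1 => [|g]; last by rewrite mem_index_enum.
rewrite mul1r; apply: le_trans; rewrite le_eqVlt; apply/orP; left; apply/eqP.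
apply: eq_iidE => ws _.
rewrite [X in _ = X * _]big1 => [|g]; last by rewrite mem_index_enum.
by rewrite mul1r add0r.
Qed.

(** Variances of independent tapes add up, and the second moment about [b] is the variance plus the
    squared bias. *)
Lemma tapeE_sqr (mean var : G -> R) gs a b :
  (forall g, iidE (bern (p g)) (N g) (Z g) = mean g) ->
  (forall g, iidE (bern (p g)) (N g) (fun y => Z g y ^+ 2) = mean g ^+ 2 + var g) ->
  tapeE (fun t => (t - b) ^+ 2) gs a =
  \sum_(g <- gs) var g + (a + \sum_(g <- gs) mean g - b) ^+ 2.
Proof.
move=> EZ EZ2; elim: gs a => [|g gs IH] a /=; first by rewrite !big_nil add0r addr0.
rewrite !big_cons.
set V := \sum_(h <- gs) var h; set M := \sum_(h <- gs) mean h.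
pose c := a + M - b.
rewrite (eq_iidE (g := fun y => Z g y ^+ 2 + (2 * c * Z g y + (V + c ^+ 2)))) => [|y _].
  rewrite iidED EZ2 iidED iidEZ EZ iidE_cst ?sum_bern // /c; ring.
by rewrite IH -/V -/M /c; ring.
Qed.

End ConfigSystem.

(** * Moments of the pair statistic *)

Section PairStatistic.
Variable R : realType.
Implicit Types (p q : R) (y : bitseq).

Definition dev_sum q y : R := \sum_(b <- y) ((b : nat)%:R - q).

(* Equal to the sum of [(y_k - q) (y_l - q)] over the ordered pairs k <> l. *)
Definition pair_sum q y : R :=
  dev_sum q y ^+ 2 - \sum_(b <- y) ((b : nat)%:R - q) ^+ 2.

Lemma dev_sum_cons q b y : dev_sum q (b :: y) = ((b : nat)%:R - q) + dev_sum q y.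
Proof. by rewrite /dev_sum big_cons. Qed.

Lemma pair_sum_cons q b y :
  pair_sum q (b :: y) = pair_sum q y + 2 * ((b : nat)%:R - q) * dev_sum q y.
Proof. by rewrite /pair_sum dev_sum_cons big_cons; ring. Qed.

(** The form evaluated by the program, which stores only the number of ones. *)
Lemma pair_sum_count q y :
  pair_sum q y = ((count id y)%:R - (size y)%:R * q) ^+ 2
                 - (count id y)%:R * (1 - 2 * q) - (size y)%:R * q ^+ 2.
Proof.
rewrite /pair_sum; have -> : dev_sum q y = (count id y)%:R - (size y)%:R * q.
  elim: y => [|b y IH]; first by rewrite /dev_sum big_nil /=; ring.
  by rewrite dev_sum_cons IH /= natrD -[(size y).+1%:R]natr1; ring.
have -> : \sum_(b <- y) ((b : nat)%:R - q) ^+ 2 =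
          (count id y)%:R * (1 - 2 * q) + (size y)%:R * q ^+ 2.
  elim: y => [|b y IH]; first by rewrite big_nil /=; ring.
  by rewrite big_cons IH /= natrD -[(size y).+1%:R]natr1; case: b => /=; ring.
ring.
Qed.

Lemma iidE_bern p k (f : bitseq -> R) :
  iidE (bern p) k.+1 f =
  p * iidE (bern p) k (fun y => f (true :: y)) +
  (1 - p) * iidE (bern p) k (fun y => f (false :: y)).
Proof. by rewrite /= big_bool. Qed.

(** The five moments need a joint induction: by [pair_sum_cons], one more bit turns the square of
    [pair_sum] into a combination of all of them. *)
Lemma pair_moments p q N (d := p - q) (v := p * (1 - p)) :
  [/\ iidE (bern p) N (dev_sum q) = N%:R * d,
      iidE (bern p) N (fun y => dev_sum q y ^+ 2) = N%:R * v + N%:R ^+ 2 * d ^+ 2,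
      iidE (bern p) N (pair_sum q) = N%:R * (N%:R - 1) * d ^+ 2,
      iidE (bern p) N (fun y => pair_sum q y * dev_sum q y) =
        N%:R ^+ 2 * (N%:R - 1) * d ^+ 3 + 2 * N%:R * (N%:R - 1) * d * v &
      iidE (bern p) N (fun y => pair_sum q y ^+ 2) =
        (N%:R * (N%:R - 1) * d ^+ 2) ^+ 2 + 2 * N%:R * (N%:R - 1) * v ^+ 2
        + 4 * N%:R * (N%:R - 1) ^+ 2 * d ^+ 2 * v].
Proof.
elim: N => [|N [IH1 IH2 IH3 IH4 IH5]].
  by rewrite /= /pair_sum /dev_sum !big_nil; split; ring.
(* By linearity, the induction hypotheses evaluate any combination of the five quantities and a
   constant; each claim becomes a polynomial identity after splitting on the first bit. *)
have lin (f : bitseq -> R) (c1 c2 c3 c4 c5 c6 : R) :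
    (forall y, f y = c1 * pair_sum q y ^+ 2 +
      (c2 * (pair_sum q y * dev_sum q y) + (c3 * pair_sum q y +
      (c4 * dev_sum q y ^+ 2 + (c5 * dev_sum q y + c6))))) ->
    iidE (bern p) N f =
    c1 * ((N%:R * (N%:R - 1) * d ^+ 2) ^+ 2 + 2 * N%:R * (N%:R - 1) * v ^+ 2
        + 4 * N%:R * (N%:R - 1) ^+ 2 * d ^+ 2 * v) +
    (c2 * (N%:R ^+ 2 * (N%:R - 1) * d ^+ 3 + 2 * N%:R * (N%:R - 1) * d * v) +
    (c3 * (N%:R * (N%:R - 1) * d ^+ 2) +
    (c4 * (N%:R * v + N%:R ^+ 2 * d ^+ 2) + (c5 * (N%:R * d) + c6)))).
  move=> fE; rewrite (eq_iidE (fun y _ => fE y)).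
  rewrite iidED iidEZ IH5 iidED iidEZ IH4 iidED iidEZ IH3 iidED iidEZ IH2.
  by rewrite iidED iidEZ IH1 iidE_cst ?sum_bern.
pose z (b : bool) := (b : nat)%:R - q : R.
split; rewrite iidE_bern.
- have e b := lin (fun y => dev_sum q (b :: y)) 0 0 0 0 1 (z b).
  rewrite !e => [|y|y]; rewrite ?dev_sum_cons /z -?natr1 /d /v /=; ring.
- have e b := lin (fun y => dev_sum q (b :: y) ^+ 2) 0 0 0 1 (2 * z b) (z b ^+ 2).
  rewrite !e => [|y|y]; rewrite ?dev_sum_cons /z -?natr1 /d /v /=; ring.
- have e b := lin (fun y => pair_sum q (b :: y)) 0 0 1 0 (2 * z b) 0.
  rewrite !e => [|y|y]; rewrite ?pair_sum_cons /z -?natr1 /d /v /=; ring.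
- have e b := lin (fun y => pair_sum q (b :: y) * dev_sum q (b :: y))
    0 1 (z b) (2 * z b) (2 * z b ^+ 2) 0.
  rewrite !e => [|y|y]; rewrite ?pair_sum_cons ?dev_sum_cons /z -?natr1 /d /v /=; ring.
- have e b := lin (fun y => pair_sum q (b :: y) ^+ 2) 1 (4 * z b) 0 (4 * z b ^+ 2) 0 0.
  rewrite !e => [|y|y]; rewrite ?pair_sum_cons /z -?natr1 /d /v /=; ring.
Qed.

Definition normalized_pair_sum q N y : R := pair_sum q y / (N%:R * (q * (1 - q))).

(** The chi-square divergence of two Bernoulli laws, [(p - q)^2 / q + (p - q)^2 / (1 - q)]. *)
Definition chi2 p q : R := (p - q) ^+ 2 / (q * (1 - q)).

Definition pair_variance p q N : R :=
  (2 * N%:R * (N%:R - 1) * (p * (1 - p)) ^+ 2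
   + 4 * N%:R * (N%:R - 1) ^+ 2 * (p - q) ^+ 2 * (p * (1 - p)))
  / (N%:R * (q * (1 - q))) ^+ 2.

Lemma normalized_mean p q N : (0 < N)%N -> 0 < q < 1 ->
  iidE (bern p) N (normalized_pair_sum q N) = (N%:R - 1) * chi2 p q.
Proof.
move=> N0 /andP[q0 q1]; have [_ _ E _ _] := pair_moments p q N.
rewrite (eq_iidE (g := fun y => (N%:R * (q * (1 - q)))^-1 * pair_sum q y)) => [|y _].
  rewrite iidEZ E /chi2; field.
  by rewrite (gt_eqF q0) subr_eq0 (gt_eqF q1) pnatr_eq0 -lt0n N0.
by rewrite /normalized_pair_sum mulrC.
Qed.

Lemma normalized_second_moment p q N : (0 < N)%N -> 0 < q < 1 ->
  iidE (bern p) N (fun y => normalized_pair_sum q N y ^+ 2) =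
  ((N%:R - 1) * chi2 p q) ^+ 2 + pair_variance p q N.
Proof.
move=> N0 /andP[q0 q1]; have [_ _ _ _ E] := pair_moments p q N.
rewrite (eq_iidE (g := fun y => ((N%:R * (q * (1 - q))) ^- 2) * pair_sum q y ^+ 2)) => [|y _].
  rewrite iidEZ E /chi2 /pair_variance; field.
  by rewrite (gt_eqF q0) subr_eq0 (gt_eqF q1) pnatr_eq0 -lt0n N0.
by rewrite /normalized_pair_sum expr_div_n mulrC.
Qed.

Lemma chi2_ge0 p q : 0 < q < 1 -> 0 <= chi2 p q.
Proof.
case/andP=> q0 q1; apply: divr_ge0; first exact: sqr_ge0.
by apply: mulr_ge0; rewrite ?subr_ge0 ltW.
Qed.

(** Since [p (1 - p) <= q (1 - q) + |p - q|], the ratio of the two variances is at most [1 + t],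
    where [t ^ 2] is [chi2 p q] times the inverse variance of [q]. The term linear in [t] is split
    by AM-GM with a weight that leaves the coefficient [1 / 160] on the squared mean, small enough
    for Chebyshev; [644 = 4 + 640] collects the terms in [H]. *)
Lemma pair_variance_le p q N (H : R) : (0 < N)%N -> 0 < q < 1 -> 0 <= p <= 1 ->
  (q * (1 - q))^-1 <= H ->
  pair_variance p q N <=
  4 + N%:R * chi2 p q * (644 * H + 4) + (N%:R * chi2 p q) ^+ 2 / 160.
Proof.
move=> N0 q01 p01 rH; have chi0 := chi2_ge0 p q01; move: q01 p01 => /andP[q0 q1] /andP[p0 p1].
have N1 : 1 <= N%:R :> R by rewrite ler1n.
set M := N%:R in N1 *.
pose r := (q * (1 - q))^-1; rewrite -/r in rH.
have rho0 : 0 < q * (1 - q) by rewrite mulr_gt0 // subr_gt0.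
have r0 : 0 < r by rewrite invr_gt0.
pose v := p * (1 - p).
have v0 : 0 <= v by rewrite mulr_ge0 // subr_ge0.
pose d := `|p - q|; have d0 : 0 <= d by rewrite normr_ge0.
have vd : v <= q * (1 - q) + d.
  have : v - q * (1 - q) <= d.
    have -> : v - q * (1 - q) = (p - q) * (1 - p - q) by rewrite /v; ring.
    apply: (le_trans (ler_norm _)); rewrite normrM -/d -[leRHS]mulr1.
    by apply: ler_wpM2l => //; rewrite ler_norml; lra.
  lra.
pose w := v * r; pose t := d * r.
have w0 : 0 <= w by rewrite mulr_ge0 // ltW.
have t0 : 0 <= t by rewrite mulr_ge0 // ltW.
have wt : w <= 1 + t.
  have -> : 1 + t = (q * (1 - q) + d) * r by rewrite mulrDl divff ?gt_eqF.
  by apply: ler_wpM2r => //; exact: ltW.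
pose x := chi2 p q.
have xt : t ^+ 2 = x * r.
  by rewrite /t exprMn /d real_normK ?num_real // /x /chi2 -/r; ring.
rewrite -/x in chi0 *.
have varE : pair_variance p q N = 2 * (1 - M^-1) * w ^+ 2 + 4 * (M - 1) ^+ 2 / M * x * w.
  rewrite /pair_variance -/M /w /v /x /chi2 /r; field.
  by rewrite (gt_eqF q0) subr_eq0 (gt_eqF q1) gt_eqF // (lt_le_trans ltr01).
have M0 : 0 < M by exact: lt_le_trans ltr01 N1.
have T1 : 2 * (1 - M^-1) * w ^+ 2 <= 4 + 4 * (x * r).
  apply: (@le_trans _ _ (2 * w ^+ 2)).
    apply: ler_wpM2r; first exact: sqr_ge0.
    have : 0 < M^-1 by rewrite invr_gt0.
    lra.
  have w2 : w ^+ 2 <= (1 + t) ^+ 2 by rewrite ler_sqr ?nnegrE // addr_ge0.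
  rewrite -xt; have := sqr_ge0 (1 - t); lra.
have T2 : 4 * (M - 1) ^+ 2 / M * x * w <= 4 * M * x * (1 + t).
  apply: ler_pM => //.
  - by rewrite mulr_ge0 // mulr_ge0 ?invr_ge0 ?(ltW M0) // mulr_ge0 ?sqr_ge0.
  - apply: ler_wpM2r => //; rewrite ler_pdivrMr // -[leRHS]mulrA; apply: ler_wpM2l => //; nra.
(* AM-GM: [2 t <= x / 320 + 320 r], since [t ^ 2 = x * r] *)
have T3 : 2 * t <= x / 320 + 320 * r.
  have sq := sqr_ge0 (x / 320 - 320 * r).
  have ge0 : 0 <= x / 320 + 320 * r by lra.
  have t20 : 0 <= 2 * t by lra.
  rewrite -ler_sqr ?nnegrE //.
  by rewrite exprMn xt; lra.
have T4 : 4 * M * x * (1 + t) <= 4 * M * x + M * x * (x / 160 + 640 * r).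
  have := ler_wpM2l (mulr_ge0 (ltW M0) chi0) T3; lra.
have T5 : x * r <= M * x * H.
  rewrite [x * r]mulrC -[M * x * H]mulrA; apply: (@le_trans _ _ (x * H)).
    by rewrite mulrC; apply: ler_wpM2l.
  rewrite ler_peMl // mulr_ge0 //; lra.
have T6 : M * x * r <= M * x * H by apply: ler_wpM2l => //; rewrite mulr_ge0 // ltW.
have T7 : M * x * x <= (M * x) ^+ 2.
  by rewrite expr2; apply: ler_wpM2l; rewrite ?ler_peMl // mulr_ge0 // ltW.
rewrite varE.
lra.
Qed.

End PairStatistic.

(** * Chi-square bound on the distance *)

Section ChiSquareBound.
Variables (R : realType) (n : nat) (G : finType).
Variables (pos : 'I_n -> cube n -> G) (owner : G -> 'I_n).
Hypothesis owner_pos : forall i x, owner (pos i x) = i.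
Hypothesis pos_prefix : forall (i : 'I_n) (x y : cube n),
  (forall j : 'I_n, (j < i)%N -> x j = y j) -> pos i x = pos i y.
Variables (P Q : cube n -> R) (p q : G -> R).
Hypothesis PF : factorizes pos P p.
Hypothesis QF : factorizes pos Q q.
Hypothesis q01 : forall g, 0 < q g < 1.

Local Notation hit := (hit pos owner).
Local Notation bit := (hit_bit owner).

Definition hit_prob (P : cube n -> R) g := Pr P (hit g).

Hypothesis P_marginal : forall g b,
  \sum_(x | hit g x && (bit g x == b)) P x = hit_prob P g * bern (p g) b.

Lemma chi2_sum (r : R) (s : R) : 0 < s < 1 ->
  \sum_b bern r b * (bern r b / bern s b - 1) = chi2 r s.
Proof.
case/andP=> s0 s1; rewrite big_bool /bern /chi2 /=; field.
by rewrite (gt_eqF s0) subr_eq0 (gt_eqF s1).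
Qed.

Lemma sum_hit (F : G -> R) x : \sum_i F (pos i x) = \sum_(g | hit g x) F g.
Proof.
rewrite [RHS](reindex_onto (pos^~ x) owner) => [|g /eqP //].
by apply: eq_bigl => i; rewrite /hit owner_pos !eqxx.
Qed.

Lemma expect_node_sum (F : G -> bool -> R) :
  \sum_x P x * (\sum_i F (pos i x) (x i)) =
  \sum_g hit_prob P g * \sum_b bern (p g) b * F g b.
Proof.
transitivity (\sum_x \sum_(g | hit g x) P x * F g (bit g x)).
  apply: eq_bigr => x _; rewrite -(sum_hit (fun g => P x * F g (bit g x))) mulr_sumr.
  by apply: eq_bigr => i _; rewrite /hit_bit owner_pos.
rewrite (exchange_big_dep xpredT) //=; apply: eq_bigr => g _.
rewrite (partition_big (bit g) xpredT) //= mulr_sumr; apply: eq_bigr => b _.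
rewrite mulrA -P_marginal mulr_suml; apply: eq_bigr => x /andP[_ /eqP <-] //.
Qed.

(** Replaces [ln (P x / Q x)], using [ln u <= u - 1] at each node, and makes sense also where
    [P x = 0]. Its mean under [P] is the weighted sum of the [chi2]. *)
Definition node_excess x :=
  \sum_i (bern (p (pos i x)) (x i) / bern (q (pos i x)) (x i) - 1).

Lemma likelihood_le x : P x <= Q x * expR (node_excess x).
Proof.
have [[p01 PE] [_ QE]] := (PF, QF).
rewrite PE QE /node_excess expR_sum -big_split /=; apply: ler_prod => i _.
rewrite bern_ge0 //=; set r := bern _ _; set s := bern _ _.
have s0 : 0 < s.
  by rewrite /s /bern; case/andP: (q01 (pos i x)) => q0 q1; case: ifP; rewrite ?subr_gt0.
have -> : r = s * (1 + (r / s - 1)) by field; rewrite gt_eqF.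
apply: ler_wpM2l; first exact: ltW.
have -> : s * (1 + (r / s - 1)) / s - 1 = r / s - 1 by field; rewrite gt_eqF.
exact: expR_ge1Dx.
Qed.

(** With [K] the excess, [likelihood_le] gives [Q x >= P x exp (- K)], so [sqrt (P x Q x) >= P x exp
    (- K / 2) >= P x (1 - K / 2)]. *)
Lemma hellinger_point_le x :
  (Num.sqrt (P x) - Num.sqrt (Q x)) ^+ 2 <= Q x - P x + P x * node_excess x.
Proof.
have P0 := factorizes_ge0 PF x; have Q0 := factorizes_ge0 QF x.
set K := node_excess x.
suff : P x * (1 - K / 2) <= Num.sqrt (P x) * Num.sqrt (Q x).
  by rewrite sqrrB !sqr_sqrtr //; lra.
apply: (@le_trans _ _ (P x * expR (- (K / 2)))).
  by apply: ler_wpM2l => //; exact: expR_ge1Dx.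
rewrite -sqrtrM // -[leLHS]ger0_norm ?mulr_ge0 ?expR_ge0 // -sqrtr_sqr.
apply: ler_wsqrtr; rewrite exprMn expr2 -mulrA; apply: ler_wpM2l => //.
have -> : expR (- (K / 2)) ^+ 2 = expR (- K).
  by rewrite -expRM_natl; congr expR; lra.
by rewrite expRN -ler_pdivlMr ?invr_gt0 ?expR_gt0 // invrK likelihood_le.
Qed.

(** Summing [hellinger_point_le] bounds the squared Hellinger distance, as the masses of [P] and [Q]
    cancel. Then [|P - Q|] factors as [|sqrt P - sqrt Q| (sqrt P + sqrt Q)], and 4 bounds the sum of
    the squares of the second factor. *)
Lemma l1_dist_le_chi2 :
  l1_dist P Q ^+ 2 <= 4 * \sum_g hit_prob P g * chi2 (p g) (q g).
Proof.
set K := \sum_g _; set l := l1_dist P Q.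
have K_E : \sum_x P x * node_excess x = K.
  rewrite /node_excess (expect_node_sum (fun g b => bern (p g) b / bern (q g) b - 1)).
  by apply: eq_bigr => g _; rewrite chi2_sum.
have sP := factorizes_sum pos_prefix PF; have sQ := factorizes_sum pos_prefix QF.
have HK : \sum_x (Num.sqrt (P x) - Num.sqrt (Q x)) ^+ 2 <= K.
  apply: (le_trans (ler_sum _ (fun x _ => hellinger_point_le x))).
  by rewrite big_split /= sumrB sP sQ K_E subrr add0r.
have l0 : 0 <= l by apply: sumr_ge0 => x _; exact: normr_ge0.
have [l1|/negP] := boolP (l == 0).
  rewrite (eqP l1) expr0n /= mulr_ge0 //; apply: le_trans HK.
  by apply: sumr_ge0 => x _; exact: sqr_ge0.
move=> /negP lne; have {lne}lp : 0 < l by rewrite lt_neqAle eq_sym lne.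
(* AM-GM with the optimal constant [t]; this replaces Cauchy-Schwarz. *)
have key t : 0 < t -> l <= (t * K + 4 / t) / 2.
  move=> t0; have tV : 0 < t^-1 by rewrite invr_gt0.
  apply: (@le_trans _ _ (\sum_x (t * (Num.sqrt (P x) - Num.sqrt (Q x)) ^+ 2
      + t^-1 * (2 * (P x + Q x))) / 2)).
    apply: ler_sum => x _.
    have P0 := factorizes_ge0 PF x; have Q0 := factorizes_ge0 QF x.
    set a := Num.sqrt (P x); set b := Num.sqrt (Q x).
    have a0 : 0 <= a := sqrtr_ge0 _; have b0 : 0 <= b := sqrtr_ge0 _.
    have PE : P x = a ^+ 2 by rewrite sqr_sqrtr.
    have QE : Q x = b ^+ 2 by rewrite sqr_sqrtr.
    rewrite PE QE subr_sqr normrM (ger0_norm (addr_ge0 a0 b0)).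
    set d := a - b; set e := `|d|.
    have e2 : d ^+ 2 = e ^+ 2 by rewrite real_normK ?num_real.
    rewrite e2 ler_pdivlMr //.
    have h1 : (a + b) ^+ 2 <= 2 * (a ^+ 2 + b ^+ 2).
      by have := sqr_ge0 (a - b); lra.
    have h2 := ler_wpM2l (ltW tV) h1.
    have h3 : 0 <= t * (e - t^-1 * (a + b)) ^+ 2 by rewrite mulr_ge0 ?sqr_ge0 // ltW.
    have h4 : t * (e - t^-1 * (a + b)) ^+ 2 =
        t * e ^+ 2 - 2 * (e * (a + b)) + t^-1 * (a + b) ^+ 2.
      by field; rewrite gt_eqF.
    lra.
  rewrite -mulr_suml big_split /= -!mulr_sumr big_split /= sP sQ.
  rewrite ler_pM2r ?invr_gt0 //; have := ler_wpM2l (ltW t0) HK.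
  have -> : t^-1 * (2 * (1 + 1)) = 4 / t by ring.
  lra.
have l4 : 0 < 4 / l by rewrite divr_gt0.
have := key _ l4.
have -> : (4 / l * K + 4 / (4 / l)) / 2 = (2 * K) / l + l / 2 by field; rewrite gt_eqF.
rewrite -lerBlDr (_ : l - l / 2 = l / 2); last by lra.
rewrite ler_pdivlMr //; lra.
Qed.

End ChiSquareBound.

(** * Error probabilities of the tester *)

Lemma sum_sqr_le (R : realType) (I : finType) (x : I -> R) :
  (forall i, 0 <= x i) -> \sum_i x i ^+ 2 <= (\sum_i x i) ^+ 2.
Proof.
move=> x0; rewrite [leRHS]expr2 mulr_suml; apply: ler_sum => i _.
rewrite expr2; apply: ler_wpM2l => //.
by rewrite (bigD1 i) //= lerDl sumr_ge0.
Qed.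

Section Tester.
Variables (R : realType) (n : nat) (G : finType).
Variables (pos : 'I_n -> cube n -> G) (owner : G -> 'I_n).
Hypothesis owner_pos : forall i x, owner (pos i x) = i.
Hypothesis pos_prefix : forall (i : 'I_n) (x y : cube n),
  (forall j : 'I_n, (j < i)%N -> x j = y j) -> pos i x = pos i y.
Variables (q : G -> R) (m tau : nat) (eps : R).

Local Notation hit := (hit pos owner).
Local Notation tape := (tape pos owner).
Local Notation hit_prob := (hit_prob pos owner).

Definition hits (ws : seq (cube n)) (g : G) := count (hit g) ws.

Definition enough (N : G -> nat) ws :=
  [forall g, (tau <= N g)%N && (N g <= hits ws g)%N].

Definition statistic (N : G -> nat) ws : R :=
  \sum_g normalized_pair_sum (q g) (N g) (take (N g) (tape g ws)).

Definition decide ws1 ws2 : bool :=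
  enough (hits ws1) ws2 && (64 * statistic (hits ws1) ws2 <= m%:R * eps ^+ 2).

Lemma size_tape g ws : size (tape g ws) = hits ws g.
Proof. by rewrite size_map size_filter. Qed.

Section OneSource.
Variables (P : cube n -> R) (p : G -> R).
Hypothesis PF : factorizes pos P p.

Let P0 := factorizes_ge0 PF.
Let P1 := factorizes_sum pos_prefix PF.

Lemma hit_prob_ge0 g : 0 <= hit_prob P g.
Proof. exact: sumr_ge0. Qed.

(** The hits are a sum of [k] independent indicators. Values [a < 1] serve for lower tails, and
    [a = 2] for the first batch in [fewer_hits_le]. *)
Lemma hits_mgf_le k g (a : R) : 0 <= a ->
  iidE P k (fun ws => a ^+ hits ws g) <= expR (k%:R * ((a - 1) * hit_prob P g)).
Proof.
move=> a0.
rewrite (eq_iidE (g := fun ws => \prod_(x <- ws) (if hit g x then a else 1))) => [|ws _].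
  rewrite iidE_prod expRM_natl; apply: lerXn2r; rewrite ?nnegrE ?expR_ge0 //.
    by apply: sumr_ge0 => x _; rewrite mulr_ge0 //; case: ifP.
  apply: le_trans (expR_ge1Dx _).
  rewrite le_eqVlt; apply/orP; left; apply/eqP.
  rewrite /hit_prob /Pr [in RHS]big_mkcond mulr_sumr -[X in _ = X + _]P1.
  rewrite -big_split /=.
  by apply: eq_bigr => x _; case: ifP => _; ring.
rewrite /hits; elim: ws => [|x ws IH]; rewrite ?big_nil ?big_cons //= -IH exprD.
by case: (hit g x); rewrite ?expr1 ?expr0.
Qed.

(** Chernoff bound with [a = exp (-1)], using [1 - a >= 1 / 2]. *)
Lemma few_hits_le k g (s : R) :
  iidE P k (fun ws => ((hits ws g)%:R < s)%R%:R) <=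
  expR (s - k%:R * (hit_prob P g / 2)).
Proof.
pose a : R := expR (-1).
have a2 : a <= 2^-1.
  rewrite /a expRN lef_pV2 ?posrE ?expR_gt0 //; have := expR_ge1Dx (1 : R); lra.
have h ws : ((hits ws g)%:R < s)%R%:R <= expR s * a ^+ hits ws g.
  rewrite /a -expRM_natl -expRD; case: ltP => [lt|_]; last exact: expR_ge0.
  by apply: le_trans (expR_ge1Dx _); rewrite mulrN1 /=; lra.
apply: (@le_trans _ _ (iidE P k (fun ws => expR s * a ^+ hits ws g))).
  exact: ler_iidE.
rewrite iidEZ expRD; apply: ler_wpM2l; first exact: expR_ge0.
apply: (le_trans (hits_mgf_le k g (expR_ge0 _))); rewrite ler_expR -mulrN -/a.
apply: ler_wpM2l => //; have := ler_wpM2r (hit_prob_ge0 g) a2; lra.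
Qed.

(** Chernoff bound with [a = 1 / 2]: for [t = tau] the prefactor [2 ^ tau] is of order D, and a
    logarithmic number of expected hits compensates it. *)
Lemma few_hits_dyadic_le k g t :
  iidE P k (fun ws => (hits ws g < t)%:R) <=
  2 ^+ t * expR (- (k%:R * (hit_prob P g / 2))).
Proof.
have h ws : (hits ws g < t)%N%:R <= (2 ^+ t : R) * 2^-1 ^+ hits ws g.
  case: ltnP => [lt|_]; last by rewrite mulr_ge0 // exprn_ge0 // invr_ge0.
  rewrite exprVn -expfB // exprn_ege1 //; lra.
apply: (@le_trans _ _ (iidE P k (fun ws => 2 ^+ t * 2^-1 ^+ hits ws g))).
  exact: ler_iidE.
rewrite iidEZ; apply: ler_wpM2l; first exact: exprn_ge0.
have h0 : 0 <= 2^-1 :> R by rewrite invr_ge0.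
apply: (le_trans (hits_mgf_le k g h0)); rewrite ler_expR -mulrN.
by apply: ler_wpM2l => //; lra.
Qed.

(** The indicator is at most 2 to the difference of the two counts. With [pi] the hit probability,
    the exponents are [k pi] for the first batch and [- 3 k pi / 2] for the second, adding up to
    [- k pi / 2]: this is the origin of the factor 3. *)
Lemma fewer_hits_le k g :
  iidE P k (fun s1 => iidE P (3 * k) (fun s2 => (hits s2 g < hits s1 g)%:R)) <=
  expR (- (k%:R * (hit_prob P g / 2))).
Proof.
have h s1 s2 : (hits s2 g < hits s1 g)%N%:R <=
    (2 ^+ hits s1 g : R) * 2^-1 ^+ hits s2 g.
  case: ltnP => [lt|_].
    by rewrite exprVn -expfB // exprn_ege1 //; lra.
  by rewrite mulr_ge0 // exprn_ge0 // invr_ge0.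
have h0 : 0 <= 2^-1 :> R by rewrite invr_ge0.
apply: (@le_trans _ _ (iidE P k (fun s1 =>
   expR ((3 * k)%:R * ((2^-1 - 1) * hit_prob P g)) * 2 ^+ hits s1 g))).
  apply: ler_iidE => // s1 _; 
  apply: (@le_trans _ _ (iidE P (3 * k) (fun s2 => 2 ^+ hits s1 g * 2^-1 ^+ hits s2 g))).
    exact: ler_iidE.
  rewrite iidEZ mulrC; apply: ler_wpM2r; first exact: exprn_ge0.
  exact: hits_mgf_le.
rewrite iidEZ; apply: (@le_trans _ _ (expR ((3 * k)%:R * ((2^-1 - 1) * hit_prob P g)) *
   expR (k%:R * ((2 - 1) * hit_prob P g)))).
  by apply: ler_wpM2l; rewrite ?expR_ge0 // hits_mgf_le.
by rewrite -expRD ler_expR natrM; lra.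
Qed.

Hypothesis q01 : forall g, 0 < q g < 1.

(** Chebyshev about [b], transferred to independent tapes because the square is nonnegative.
    Completeness takes [b = 0], soundness takes the mean. *)
Lemma chebyshev_statistic (N : G -> nat) k (b c : R) (E : pred R) :
  (forall g, 0 < N g)%N -> 0 < c ->
  (forall t, E t -> c <= (t - b) ^+ 2) ->
  iidE P k (fun ws => (enough N ws && E (statistic N ws))%:R) <=
  (\sum_g pair_variance (p g) (q g) (N g) +
   (\sum_g ((N g)%:R - 1) * chi2 (p g) (q g) - b) ^+ 2) / c.
Proof.
move=> N0 c0 Ec.
pose Z g y := normalized_pair_sum (q g) (N g) y.
pose phi t := (t - b) ^+ 2.
have phi0 t : 0 <= phi t by exact: sqr_ge0.
rewrite ler_pdivlMr // mulrC -iidEZ.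
have := tape_le_enum owner_pos pos_prefix PF N Z k phi0.
rewrite (tapeE_sqr (mean := fun g => ((N g)%:R - 1) * chi2 (p g) (q g))
  (var := fun g => pair_variance (p g) (q g) (N g))); first last.
- by move=> g; exact: normalized_second_moment.
- by move=> g; exact: normalized_mean.
rewrite add0r; apply: le_trans; apply: ler_iidE => // ws _.
case: (boolP (enough N ws)) => [/forallP en|_]; last first.
  by rewrite mulr0 mulr_ge0 //; apply: prodr_ge0 => g _; rewrite ler0n.
rewrite [X in _ <= X * _]big1 ?mul1r => [|g _]; last first.
  by rewrite size_tape; case/andP: (en g) => _ ->.
rewrite /= -/(statistic N ws); case: (boolP (E _)) => [Et|_]; rewrite ?mulr1 ?mulr0 //.
exact: Ec.
Qed.

End OneSource.

Variable h : R.
Hypothesis h1 : 1 <= h.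
Hypothesis hG : h ^+ 2 = #|G|%:R.
Hypothesis q01 : forall g, 0 < q g < 1.
Hypothesis q_balanced : forall g, (q g * (1 - q g))^-1 <= h / 1000.
Hypothesis m_large : 32 * 1000 * h <= m%:R * eps ^+ 2.
Hypothesis tau2 : (2 <= tau)%N.

Section Completeness.
Variable Q : cube n -> R.
Hypothesis QF : factorizes pos Q q.
Hypothesis hits_likely : forall g,
  #|G|%:R * ((2 ^+ tau + 1) * expR (- (m%:R * (hit_prob Q g / 2)))) <= 1 / 10.

Lemma reject_prob_le :
  iidE Q m (fun s1 => iidE Q (3 * m) (fun s2 => (~~ decide s1 s2)%:R)) <= 1 / 3.
Proof.
have h_ge1 := h1; have mL := m_large.
have Q0 := factorizes_ge0 QF; have Q1 := factorizes_sum pos_prefix QF.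
pose bad1 s1 : R := \sum_g (hits s1 g < tau)%N%:R.
pose bad2 s1 s2 : R := \sum_g (hits s2 g < hits s1 g)%N%:R.
have bad1P s1 : bad1 s1 = 0 -> forall g, (tau <= hits s1 g)%N.
  move=> b0 g; rewrite leqNgt; apply/negP => lt; move: b0; apply/eqP; rewrite gt_eqF //.
  by rewrite /bad1 (bigD1 g) //= lt ltr_pwDl // sumr_ge0.
have stat s1 : (forall g, (tau <= hits s1 g)%N) ->
    iidE Q (3 * m) (fun s2 => (enough (hits s1) s2 &&
      (m%:R * eps ^+ 2 < 64 * statistic (hits s1) s2))%R%:R) <= 1 / 10.
  move=> N0.
  have c0 : 0 < (m%:R * eps ^+ 2 / 64) ^+ 2 by rewrite exprn_gt0 //; lra.
  have h0 : 0 <= h by lra.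
  have Npos g : (0 < hits s1 g)%N by apply: leq_trans (N0 g); exact: ltnW.
  pose big t := m%:R * eps ^+ 2 < 64 * t.
  have bigP t : big t -> (m%:R * eps ^+ 2 / 64) ^+ 2 <= (t - 0) ^+ 2.
    by rewrite /big => lt; rewrite subr0 ler_sqr ?nnegrE; lra.
  apply: (le_trans (chebyshev_statistic QF q01 (3 * m) Npos c0 bigP)).
  rewrite [X in _ + X](_ : _ = 0) ?addr0; last first.
    by rewrite big1 ?subrr ?expr0n // => g _; rewrite /chi2 subrr expr0n mul0r mulr0.
  rewrite ler_pdivrMr //.
  apply: (@le_trans _ _ (\sum_(g : G) 4)).
    apply: ler_sum => g _.
    have g0 : (0 < hits s1 g)%N by apply: leq_trans (N0 g); exact: ltnW.
    have [q0 q1] := andP (q01 g).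
    have q01' : 0 <= q g <= 1 by rewrite !ltW.
    apply: (le_trans (pair_variance_le g0 (q01 g) q01' (q_balanced g))).
    by rewrite /chi2 subrr expr0n !mul0r mulr0 mul0r expr0n mul0r !addr0.
  rewrite sumr_const -[_ *+ _]mulr_natr -hG.
  (* [500 = 32 * 1000 / 64] by [m_large]; the variance is at most [4 h ^ 2]. *)
  have : (500 * h) ^+ 2 <= (m%:R * eps ^+ 2 / 64) ^+ 2 by rewrite ler_sqr ?nnegrE; lra.
  have := sqr_ge0 h; rewrite exprMn; lra.
(* [bad1] counts configurations; once it reaches 1 the trivial bound 1 on the inner expectation is
   enough. *)
have stat0 s1 : 0 < bad1 s1 -> 1 <= bad1 s1.
  move=> b0; have [g lt|ge] := pickP (fun g => (hits s1 g < tau)%N).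
    by rewrite /bad1 (bigD1 g) //= lt lerDl sumr_ge0.
  by move: b0; rewrite /bad1 big1 ?ltxx // => g _; rewrite ge.
apply: (@le_trans _ _ (iidE Q m (fun s1 => bad1 s1 +
   (iidE Q (3 * m) (fun s2 => bad2 s1 s2) + 1 / 10)))).
  apply: ler_iidE => // s1 _.
  have bad10 : 0 <= bad1 s1 by exact: sumr_ge0.
  have bad20 s2 : 0 <= bad2 s1 s2 by exact: sumr_ge0.
  have [b0|bne] := eqVneq (bad1 s1) 0; last first.
    have b1 : 1 <= bad1 s1 by apply: stat0; rewrite lt_neqAle eq_sym bne.
    have : iidE Q (3 * m) (fun s2 => (~~ decide s1 s2)%:R) <= 1.
      rewrite -[leRHS](iidE_cst (3 * m) 1 Q1); apply: ler_iidE => // s2 _.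
      by rewrite lern1 leq_b1.
    have : 0 <= iidE Q (3 * m) (bad2 s1) by apply: iidE_ge0.
    lra.
  rewrite b0 add0r.
  apply: le_trans (lerD (lexx _) (stat s1 (bad1P s1 b0))); rewrite -iidED.
  apply: ler_iidE => // s2 _; rewrite /decide negb_and -ltNge.
  case: (boolP (enough _ _)) => [_ /=|/forallPn[g]]; first by rewrite lerDr.
  rewrite negb_and -!ltnNge => /orP[lt|lt].
    by have := bad1P s1 b0 g; rewrite leqNgt lt.
  by rewrite /= addr0 /bad2 (bigD1 g) //= lt lerDl sumr_ge0.
rewrite iidED iidED (iidE_cst _ _ Q1) /bad1 iidE_sum.
have e : iidE Q m (fun s1 => iidE Q (3 * m) (fun s2 => bad2 s1 s2)) =
   \sum_g iidE Q m (fun s1 => iidE Q (3 * m) (fun s2 => (hits s2 g < hits s1 g)%N%:R)).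
  by rewrite -iidE_sum; apply: eq_iidE => s1 _; rewrite -iidE_sum.
rewrite e addrA -big_split /=.
suff : \sum_g (iidE Q m (fun ws => (hits ws g < tau)%N%:R) +
    iidE Q m (fun s1 => iidE Q (3 * m) (fun s2 => (hits s2 g < hits s1 g)%N%:R)))
   <= 1 / 10 by lra.
have [G0|Gn0] := posnP #|G|.
  by rewrite big1 //= => [|g]; [lra|have := card0_eq G0 g; rewrite inE].
apply: (@le_trans _ _ (\sum_(g : G) #|G|%:R^-1 / 10)).
  apply: ler_sum => g _.
  have hg := hits_likely g.
  apply: (le_trans (lerD (few_hits_dyadic_le QF m g tau) (fewer_hits_le QF m g))).
  rewrite -[X in _ + X]mul1r -mulrDl.
  have Gp : 0 < #|G|%:R :> R by rewrite ltr0n.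
  rewrite -(ler_pM2l Gp); apply: (le_trans hg).
  by rewrite mulrA divff ?gt_eqF // mul1r.
rewrite sumr_const -[_ *+ _]mulr_natr mulrAC mulVf ?mul1r //.
by rewrite pnatr_eq0 -lt0n.
Qed.

End Completeness.

Section Soundness.
Variables (P Q : cube n -> R) (p : G -> R).
Hypothesis PF : factorizes pos P p.
Hypothesis QF : factorizes pos Q q.
Hypothesis P_marginal : forall g b,
  \sum_(x | hit g x && (hit_bit owner g x == b)) P x = hit_prob P g * bern (p g) b.
Hypothesis eps0 : 0 < eps.
Hypothesis far : eps < l1_dist P Q.
Hypothesis tau_large : #|G|%:R * expR (- tau%:R) <= 1 / 100 :> R.

Lemma accept_prob_le :
  iidE P m (fun s1 => iidE P (3 * m) (fun s2 => (decide s1 s2)%:R)) <= 1 / 3.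
Proof.
have h_ge1 := h1; have mL := m_large; have e0 := eps0; have lfar := far.
have P0 := factorizes_ge0 PF; have P1 := factorizes_sum pos_prefix PF.
have [p01 _] := PF.
pose pi := hit_prob P.
have pi0 g : 0 <= pi g by exact: (hit_prob_ge0 PF).
(* A configuration that passes the threshold with less than a quarter of its expected hits. This is
   impossible if [m pi g / 4 <= tau]; otherwise Chernoff gives [exp (- m pi g / 4) < exp (- tau)],
   whatever the size of [pi g]. *)
pose bad (s1 : seq (cube n)) g :=
  (tau <= hits s1 g)%N && ((hits s1 g)%:R < m%:R * pi g / 4).
have badP g : iidE P m (fun s1 => (bad s1 g)%:R) <= expR (- tau%:R).
  have [le|lt] := leP (m%:R * pi g / 4) tau%:R.
    rewrite (eq_iidE (g := fun=> 0)) ?iidE0 ?expR_ge0 // => s1 _.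
    rewrite /bad; case: leqP => //= t1; rewrite ltNge (le_trans le) // ler_nat //.
  apply: (@le_trans _ _ (expR (m%:R * pi g / 4 - m%:R * (pi g / 2)))).
    apply: le_trans (few_hits_le PF m g _); apply: ler_iidE => // s1 _.
    by rewrite /bad; case: leqP => //=; rewrite ler0n.
  by rewrite ler_expR; lra.
have main s1 : ~~ [exists g, bad s1 g] ->
    iidE P (3 * m) (fun s2 => (decide s1 s2)%:R) <= 1 / 5.
  move=> /existsPn nbad.
  have [N0|] := boolP [forall g, (tau <= hits s1 g)%N]; last first.
    move=> /forallPn[g ng].
    rewrite (eq_iidE (g := fun=> 0)) ?iidE0 ?expR_ge0 // => [|s2 _]; first by lra.
    rewrite /decide; case: (boolP (enough _ _)) => //= /forallP/(_ g)/andP[].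
    by rewrite (negbTE ng).
  move/forallP: N0 => N0.
  pose N := hits s1; pose x g := chi2 (p g) (q g).
  have x0 g : 0 <= x g by exact: chi2_ge0.
  have N2 g : 2 <= (N g)%:R :> R by rewrite ler_nat (leq_trans tau2 (N0 g)).
  have Npi g : m%:R * pi g / 4 <= (N g)%:R.
    by have := nbad g; rewrite /bad N0 /= -leNgt.
  pose X := \sum_g (N g)%:R * x g.
  pose E := \sum_g ((N g)%:R - 1) * x g.
  have XE : X <= 2 * E.
    rewrite mulr_sumr; apply: ler_sum => g _; rewrite mulrA; apply: ler_wpM2r => //.
    by have := N2 g; lra.
  have X0 : 0 <= X by apply: sumr_ge0 => g _; rewrite mulr_ge0.
  have chi := l1_dist_le_chi2 owner_pos pos_prefix PF QF q01 P_marginal.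
  have eps2 : eps ^+ 2 <= 4 * \sum_g pi g * x g.
    by apply: le_trans chi; rewrite ler_sqr ?nnegrE; lra.
  (* [32 = 4 * 4 * 2]: the distance bound, the hits against their expectation, and [N <= 2 (N - 1)],
     which holds since [tau >= 2]. *)
  have Elow : m%:R * eps ^+ 2 <= 32 * E.
    apply: (@le_trans _ _ (m%:R * (4 * \sum_g pi g * x g))).
      by apply: ler_wpM2l.
    rewrite !mulr_sumr; apply: ler_sum => g _.
    have := ler_wpM2r (x0 g) (Npi g).
    have := ler_wpM2r (x0 g) (N2 g).
    lra.
  have Eh : 1000 * h <= E by lra.
  have E0 : 0 < E by lra.
  have c0 : 0 < E ^+ 2 / 4 by rewrite divr_gt0 // exprn_gt0.
  have Npos g : (0 < N g)%N by apply: leq_trans (N0 g); exact: ltnW.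
  (* The threshold is at most half the mean [E], so acceptance means a deviation of at least
     [E / 2]. *)
  pose small t := 64 * t <= m%:R * eps ^+ 2.
  have smallP t : small t -> E ^+ 2 / 4 <= (t - E) ^+ 2.
    rewrite /small => le; have : (E / 2) ^+ 2 <= (E - t) ^+ 2 by rewrite ler_sqr ?nnegrE; lra.
    lra.
  apply: (le_trans (chebyshev_statistic PF q01 (3 * m) Npos c0 smallP)).
  rewrite subrr expr0n addr0 ler_pdivrMr //.
  (* The target is [E ^ 2 / 20]. The quadratic part is at most [X ^ 2 / 160 <= E ^ 2 / 40], and
     [E >= 1000 h] makes the other terms small. *)
  apply: (@le_trans _ _ (\sum_g (4 + ((N g)%:R * x g * (644 * (h / 1000) + 4) +
      ((N g)%:R * x g) ^+ 2 / 160)))).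
    apply: ler_sum => g _; rewrite addrA.
    by apply: pair_variance_le => //; apply: leq_trans (N0 g); exact: ltnW.
  rewrite big_split /= sumr_const -[_ *+ _]mulr_natr -hG big_split /= -!mulr_suml -/X.
  have sq : \sum_g ((N g)%:R * x g) ^+ 2 <= X ^+ 2.
    by apply: sum_sqr_le => g; rewrite mulr_ge0.
  have X2 : X ^+ 2 <= 4 * E ^+ 2.
    by rewrite (_ : 4 * _ = (2 * E) ^+ 2); [rewrite ler_sqr ?nnegrE; lra|ring].
  have h2 : 1000 * 1000 * h ^+ 2 <= E ^+ 2.
    by rewrite (_ : 1000 * 1000 * _ = (1000 * h) ^+ 2); [rewrite ler_sqr ?nnegrE; lra|ring].
  have hE : 1000 * h * E <= E ^+ 2 by rewrite expr2; apply: ler_wpM2r => //; exact: ltW.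
  have oneE : 1000 * E <= E ^+ 2.
    by rewrite expr2; apply: ler_wpM2r; [exact: ltW|lra].
  have XH : X * (644 * (h / 1000) + 4) <= 2 * E * (644 * (h / 1000) + 4).
    by apply: ler_wpM2r => //; lra.
  lra.
apply: (@le_trans _ _ (iidE P m (fun s1 => \sum_g (bad s1 g)%:R + 1 / 5))).
  apply: ler_iidE => // s1 _.
  have [/existsP[g bg]|nb] := boolP [exists g, bad s1 g]; last first.
    have : 0 <= \sum_g (bad s1 g)%:R :> R by exact: sumr_ge0.
    by have := main s1 nb; lra.
  have : 1 <= \sum_g (bad s1 g)%:R :> R by rewrite (bigD1 g) //= bg lerDl sumr_ge0.
  have : iidE P (3 * m) (fun s2 => (decide s1 s2)%:R) <= 1.
    rewrite -[leRHS](iidE_cst (3 * m) 1 P1); apply: ler_iidE => // s2 _.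
    by rewrite lern1 leq_b1.
  lra.
rewrite iidED (iidE_cst _ _ P1) iidE_sum.
have : \sum_g iidE P m (fun s1 => (bad s1 g)%:R) <= \sum_(g : G) expR (- tau%:R).
  by apply: ler_sum => g _.
rewrite sumr_const -[_ *+ _]mulr_natl; move: tau_large; lra.
Qed.

End Soundness.
End Tester.

(** * Execution of programs *)

Section Execution.
Variables (R : realType) (smp : nat -> bitseq) (coin : nat -> bool).
Local Notation step := (@step R smp coin).
Implicit Types (s : state R) (c : cmd) (Post : state R -> Prop).

(** The final state and the step count are chosen before the continuation [ks], so that executions
    compose. *)
Definition runs c s K Post := exists s' k,
  [/\ (k <= K)%N, forall ks, iter k step (c :: ks, s) = (ks, s') & Post s'].

Lemma runs_weaken c s K K' Post Post' :
  (K <= K')%N -> (forall s', Post s' -> Post' s') ->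
  runs c s K Post -> runs c s K' Post'.
Proof.
move=> KK PP [s' [k [kK ex ps]]]; exists s', k; split=> //.
  exact: leq_trans kK KK.
exact: PP.
Qed.

Lemma runs_seq c1 c2 s K1 K2 Post :
  runs c1 s K1 (fun s1 => runs c2 s1 K2 Post) ->
  runs (Seq c1 c2) s (K1 + K2).+1 Post.
Proof.
move=> [s1 [k1 [kK1 ex1 [s2 [k2 [kK2 ex2 ps]]]]]].
exists s2, (k2 + k1).+1; split=> //; first by rewrite ltnS addnC leq_add.
by move=> ks; rewrite iterSr iterD /= ex1 ex2.
Qed.

Lemma runs_if b c1 c2 s K Post :
  runs (if beval s b then c1 else c2) s K Post -> runs (If b c1 c2) s K.+1 Post.
Proof.
move=> [s1 [k1 [kK1 ex1 ps]]]; exists s1, k1.+1; split=> // ks.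
by rewrite iterSr /= ex1.
Qed.

(** The invariant is indexed by the number of completed iterations, so one induction gives
    termination, running time and postcondition. *)
Lemma runs_while b c (Inv : nat -> state R -> Prop) M K :
  (forall j s, (j < M)%N -> Inv j s -> beval s b /\ runs c s K (Inv j.+1)) ->
  (forall s, Inv M s -> ~~ beval s b) ->
  forall s, Inv 0 s -> runs (While b c) s (M * K.+1).+1 (Inv M).
Proof.
move=> loop stop.
suff main d s : (d <= M)%N -> Inv (M - d)%N s ->
    runs (While b c) s (d * K.+1).+1 (Inv M).
  by move=> s i0; apply: main => //; rewrite subnn.
elim: d s => [|d IH] s dM.
  rewrite subn0 => iM; exists s, 1; split=> // ks /=.
  by rewrite (negbTE (stop s iM)).
move=> inv; have lt : (M - d.+1 < M)%N by rewrite ltn_subrL (leq_ltn_trans _ dM).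
have [bs [s1 [k1 [kK1 ex1 inv1]]]] := loop _ s lt inv.
rewrite subnSK // in inv1.
have [s2 [k2 [kK2 ex2 ps]]] := IH s1 (ltnW dM) inv1.
exists s2, (k2 + k1).+1; split=> //.
  rewrite mulSn; lia.
by move=> ks; rewrite iterSr iterD /= bs ex1 ex2.
Qed.

Fixpoint straight c : bool :=
  match c with
  | Seq c1 c2 | If _ c1 c2 => straight c1 && straight c2
  | While _ _ => false
  | _ => true
  end.

(** Lets loop-free code be executed by simplification; the value on [While] is a dummy excluded by
    [straight]. *)
Fixpoint effect c s : state R :=
  match c with
  | Skip | While _ _ => s
  | Seq c1 c2 => effect c2 (effect c1 s)
  | If b c1 c2 => if beval s b then effect c1 s else effect c2 s
  | _ => (step ([:: c], s)).2
  end.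

Fixpoint cost c : nat :=
  match c with
  | Seq c1 c2 | If _ c1 c2 => (cost c1 + cost c2).+1
  | _ => 1
  end.

Lemma runs_straight c s Post :
  straight c -> Post (effect c s) -> runs c s (cost c) Post.
Proof.
elim: c s Post => [|X e v|X e v|X e|X e|c1 IH1 c2 IH2|b c1 IH1 c2 IH2|//] s Post /=;
  try by move=> _ ps; eexists _, 1; split; [|move=> ks /=; reflexivity|exact: ps].
- by case/andP=> s1 s2 ps; apply: runs_seq; apply: IH1 => //; exact: IH2.
- case/andP=> s1 s2 ps; apply: runs_if; case: ifP ps => _ ps.
    by apply: runs_weaken (IH1 _ _ s1 ps) => //; rewrite leq_addr.
  by apply: runs_weaken (IH2 _ _ s2 ps) => //; rewrite leq_addl.
Qed.

Fixpoint nwrites c : seq nat :=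
  match c with
  | NStore X _ _ | Draw X _ | Flip X _ => [:: X]
  | Seq c1 c2 | If _ c1 c2 => nwrites c1 ++ nwrites c2
  | While _ c1 => nwrites c1
  | _ => [::]
  end.

Fixpoint rwrites c : seq nat :=
  match c with
  | RStore X _ _ => [:: X]
  | Seq c1 c2 | If _ c1 c2 => rwrites c1 ++ rwrites c2
  | While _ c1 => rwrites c1
  | _ => [::]
  end.

Fixpoint draws c : bool :=
  match c with
  | Draw _ _ => true
  | Seq c1 c2 | If _ c1 c2 => draws c1 || draws c2
  | While _ c1 => draws c1
  | _ => false
  end.

(** [p] is a syntactic condition inherited by subcommands and [f] an observation of the state.
    Control commands only change the stack, so only atomic commands matter. *)
Lemma step_frame (p : cmd -> bool) (S : Type) (f : state R -> S) :
  (forall c1 c2, p (Seq c1 c2) = p c1 && p c2) ->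
  (forall b c1 c2, p (If b c1 c2) = p c1 && p c2) ->
  (forall b c1, p (While b c1) = p c1) ->
  (forall c s, straight c -> p c -> f (step ([:: c], s)).2 = f s) ->
  forall k ks s, all p ks -> f (iter k step (ks, s)).2 = f s.
Proof.
move=> pS pI pW pf; elim=> [//|k IH] ks s; rewrite iterSr.
case: ks => [|c ks] /=; first by move=> _; rewrite IH.
case/andP=> pc pks.
case: c pc => [|X e v|X e v|X e|X e|c1 c2|b c1 c2|b c1] pc; try by
  rewrite IH //; apply: (pf _ s _ pc).
- by rewrite IH //= pks andbT -pS.
- by rewrite IH //= pks andbT; move: pc; rewrite pI => /andP[]; case: ifP.
- by rewrite IH //; case: ifP => _ //=; rewrite pks andbT pc -(pW b) pc.
Qed.

Record frame c s s' : Prop := Frame {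
  frame_nmem : forall X j, X \notin nwrites c -> nmem s' X j = nmem s X j;
  frame_rmem : forall X j, X \notin rwrites c -> rmem s' X j = rmem s X j;
  frame_drawn : ~~ draws c -> drawn s' = drawn s }.

Lemma runs_frame c s K Post :
  runs c s K Post -> runs c s K (fun s' => Post s' /\ frame c s s').
Proof.
move=> [s' [k [kK ex ps]]]; exists s', k; split=> //; split=> //.
have -> : s' = (iter k step ([:: c], s)).2 by rewrite ex.
split=> [X j ni|X j ni|nd].
- apply: (step_frame (p := fun c => X \notin nwrites c) (f := fun s => nmem s X j)).
  + by move=> c1 c2 /=; rewrite mem_cat negb_or.
  + by move=> b c1 c2 /=; rewrite mem_cat negb_or.
  + by [].
  + case=> //= [Y e v|Y e|Y e] s0 _; rewrite inE => ne;
      by rewrite /update /write_bits (negbTE ne).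
  + by rewrite /= ni.
- apply: (step_frame (p := fun c => X \notin rwrites c) (f := fun s => rmem s X j)).
  + by move=> c1 c2 /=; rewrite mem_cat negb_or.
  + by move=> b c1 c2 /=; rewrite mem_cat negb_or.
  + by [].
  + by case=> //= Y e v s0 _; rewrite inE => ne; rewrite /update (negbTE ne).
  + by rewrite /= ni.
- apply: (step_frame (p := fun c => ~~ draws c) (f := @drawn R)).
  + by move=> c1 c2 /=; rewrite negb_or.
  + by move=> b c1 c2 /=; rewrite negb_or.
  + by [].
  + by case.
  + by rewrite /= nd.
Qed.

Lemma effect_frame c s : straight c -> frame c s (effect c s).
Proof.
move=> sc; have h : effect c s = effect c s by [].
by have [s' [k [_ _ [-> //]]]] := runs_frame (runs_straight (Post := eq (effect c s)) sc h).
Qed.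

End Execution.

(** * The program *)

(* Natural-number arrays of the tester: 3-13 hold one scalar each, in cell 0;
   15 holds the current sample, and 16, 17, 18 hold, for each configuration g,
   the number N_g of hits in the first batch, the number of hits in the second
   batch truncated at N_g, and the number of ones among these. *)
Local Notation a_n := 0%N.
Local Notation a_adj := 1%N.
Local Notation a_out := 2%N.
Local Notation v_i := 3%N.
Local Notation v_j := 4%N.
Local Notation v_addr := 5%N.
Local Notation v_size := 6%N.
Local Notation v_idx := 7%N.
Local Notation v_off := 8%N.
Local Notation v_tau := 9%N.
Local Notation v_pow := 10%N.
Local Notation v_m := 11%N.
Local Notation v_s := 12%N.
Local Notation v_g := 13%N.
Local Notation a_x := 15%N.
Local Notation a_N := 16%N.
Local Notation a_M := 17%N.
Local Notation a_Y := 18%N.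

Definition get (v : nat) := NLoad v (NConst 0).
Definition set (v : nat) (e : nexp) := NStore v (NConst 0) e.
Definition incr (v : nat) := set v (NAdd (get v) (NConst 1)).
Definition less (e1 e2 : nexp) := BLeN (NAdd e1 (NConst 1)) e2.

(** [v_addr] runs through column i of the row-major matrix with stride n, by additions since indices
    cannot be multiplied. Doubling at each parent makes [v_size] the number of configurations of the
    node and [v_idx] the parent values read in binary. *)
Definition parent_body :=
  Seq (If (BLeN (NConst 1) (NLoad a_adj (get v_addr)))
        (Seq (set v_size (NAdd (get v_size) (get v_size)))
             (set v_idx (NAdd (NAdd (get v_idx) (get v_idx)) (NLoad a_x (get v_j)))))
        Skip)
 (Seq (set v_addr (NAdd (get v_addr) (get a_n)))
      (incr v_j)).

Definition parent_loop := While (less (get v_j) (get a_n)) parent_body.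

Definition node_init :=
  Seq (set v_j (NConst 0)) (Seq (set v_size (NConst 1))
 (Seq (set v_idx (NConst 0)) (set v_addr (get v_i)))).

Definition node_end (body : cmd) :=
  Seq (set v_idx (NAdd (get v_off) (get v_idx)))
 (Seq body
 (Seq (set v_off (NAdd (get v_off) (get v_size))) (incr v_i))).

Definition node_body (body : cmd) :=
  Seq node_init (Seq parent_loop (node_end body)).

(* Runs [body] for each node, with the index of its table entry in [v_idx]. *)
Definition node_loop (body : cmd) :=
  Seq (Seq (set v_i (NConst 0)) (set v_off (NConst 0)))
      (While (less (get v_i) (get a_n)) (node_body body)).

Definition sample_loop (number : nexp) (body : cmd) :=
  Seq (set v_s (NConst 0))
      (While (less (get v_s) number)
        (Seq (Draw a_x (NConst 0)) (Seq (node_loop body) (incr v_s)))).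

Definition count_body :=
  NStore a_N (get v_idx) (NAdd (NLoad a_N (get v_idx)) (NConst 1)).

Definition read_body :=
  If (less (NLoad a_M (get v_idx)) (NLoad a_N (get v_idx)))
    (Seq (NStore a_M (get v_idx) (NAdd (NLoad a_M (get v_idx)) (NConst 1)))
         (NStore a_Y (get v_idx) (NAdd (NLoad a_Y (get v_idx)) (NLoad a_x (get v_i)))))
    Skip.

(* Ends with 128 D <= 2 ^ v_tau < 256 D, where D is the value of v_off. *)
Definition tau_loop :=
  Seq (Seq (set v_pow (NConst 1)) (set v_tau (NConst 7)))
      (While (less (get v_pow) (get v_off))
        (Seq (set v_pow (NAdd (get v_pow) (get v_pow))) (incr v_tau))).

Definition r_eps := RLoad 0 (NConst 0).
Definition r_stat := RLoad 2 (NConst 0).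
Definition r_scale := RMul (RNat (NConst 32)) (RNat (NConst 1000)).
Definition r_meps := RMul (RNat (get v_m)) (RMul r_eps r_eps).

(** Both sides are squared because the machine has no square root, and [m] is found by counting
    because it cannot round a real number; this costs O(m) steps. *)
Definition m_loop :=
  Seq (set v_m (NConst 0))
      (While (BNot (BLeR (RMul (RMul r_scale r_scale) (RNat (get v_off)))
                         (RMul r_meps r_meps)))
        (incr v_m)).

Definition r_q := RLoad 1 (get v_g).
Definition r_N := RNat (NLoad a_N (get v_g)).
Definition r_Y := RNat (NLoad a_Y (get v_g)).
Definition r_one := RNat (NConst 1).

Definition r_term :=
  RDiv (RSub (RSub (RMul (RSub r_Y (RMul r_N r_q)) (RSub r_Y (RMul r_N r_q)))
                   (RMul r_Y (RSub r_one (RMul (RNat (NConst 2)) r_q))))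
             (RMul r_N (RMul r_q r_q)))
       (RMul r_N (RMul r_q (RSub r_one r_q))).

(** If [N_g = 0] the term divides by zero and is worth 0; the cell is below the threshold, so the
    answer is already 0. *)
Definition stat_body :=
  Seq (If (BAnd (BLeN (get v_tau) (NLoad a_N (get v_g)))
                (BLeN (NLoad a_N (get v_g)) (NLoad a_M (get v_g))))
        Skip (set a_out (NConst 0)))
 (Seq (RStore 2 (NConst 0) (RAdd r_stat r_term)) (incr v_g)).

Definition stat_loop :=
  Seq (Seq (set v_g (NConst 0))
           (Seq (set a_out (NConst 1)) (RStore 2 (NConst 0) (RNat (NConst 0)))))
      (While (less (get v_g) (get v_off)) stat_body).

Definition tester_main :=
  Seq (node_loop Skip)
 (Seq tau_loop
 (Seq m_loop
 (Seq (sample_loop (get v_m) count_body)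
 (Seq (sample_loop (NAdd (get v_m) (NAdd (get v_m) (get v_m))) read_body)
 (Seq stat_loop
      (If (BLeR (RMul (RNat (NConst 64)) r_stat) r_meps)
        Skip (set a_out (NConst 0)))))))).

Definition tester :=
  If (BAnd (BLeN (NConst 1) (get a_n)) (BLeR r_eps (RNat (NConst 2))))
    tester_main (set a_out (NConst 1)).

(** * Functional model of the counters and arrays *)

Definition cell := (nat * nat * nat)%type.
Definition count_cell (b : bool) (c : cell) : cell := (c.1.1.+1, c.1.2, c.2).
Definition read_cell (b : bool) (c : cell) : cell :=
  if (c.1.2 < c.1.1)%N then (c.1.1, c.1.2.+1, (c.2 + b)%N) else c.

Section Layout.
Variables (n : nat) (adj : nat -> nat -> bool).
Implicit Type x : bitseq.

Fixpoint block_size i j : nat :=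
  if j is k.+1 then (if adj k i then (block_size i k).*2 else block_size i k) else 1.

Fixpoint block_index i x j : nat :=
  if j is k.+1 then
    (if adj k i then (block_index i x k).*2 + nth false x k else block_index i x k)%N
  else 0.

Fixpoint offset i : nat := if i is k.+1 then (offset k + block_size k n)%N else 0.

Definition table_pos i x := (offset i + block_index i x n)%N.

(** The history of cell [g] alone under one sample; following a single cell avoids describing whole
    arrays. *)
Fixpoint visit (F : bool -> cell -> cell) x g i (c : cell) : cell :=
  if i is k.+1 then
    let c' := visit F x g k c in
    if g == table_pos k x then F (nth false x k) c' else c'
  else c.

Definition visit_all F g c (xs : seq bitseq) : cell :=
  foldl (fun c x => visit F x g n c) c xs.

End Layout.

(** * Correctness and running time of the program *)

Section TesterCorrect.
Variables (R : realType) (smp : nat -> bitseq) (coin : nat -> bool).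
Variables (n : nat) (adj : nat -> nat -> bool).
Local Notation runs := (@runs R smp coin).
Local Notation effect := (@effect R smp coin).
Implicit Types (s : state R).

Definition cell_at s g : cell := (nmem s a_N g, nmem s a_M g, nmem s a_Y g).

Definition graph_in s :=
  nmem s a_n 0 = n /\
  forall i j, (i < n)%N -> (j < n)%N -> nmem s a_adj (i + j * n) = adj j i.

Definition sample_in s (x : bitseq) :=
  forall j, (j < n)%N -> nmem s a_x j = nth false x j.

Lemma parent_loop_runs s x i : graph_in s -> sample_in s x -> (i < n)%N ->
  [/\ nmem s v_j 0 = 0%N, nmem s v_size 0 = 1%N, nmem s v_idx 0 = 0%N
    & nmem s v_addr 0 = i] ->
  runs parent_loop s (n * 10).+1 (fun s' =>
    nmem s' v_size 0 = block_size adj i n /\ nmem s' v_idx 0 = block_index adj i x n).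
Proof.
move=> gr sx ilt [j0 s0 x0 a0].
pose Inv j s := [/\ graph_in s, sample_in s x, nmem s v_j 0 = j,
  nmem s v_addr 0 = (i + j * n)%N &
  nmem s v_size 0 = block_size adj i j /\ nmem s v_idx 0 = block_index adj i x j].
apply: (@runs_weaken R smp coin _ _ (n * (cost parent_body).+1).+1 _ (Inv n)) => //.
  by move=> s' [].
apply: runs_while; last by rewrite /Inv j0 s0 x0 a0 mul0n addn0.
- move=> j {gr sx j0 s0 x0 a0} t jn [[gn ga] sx tj ta [ts ti]].
  split; first by rewrite /= tj gn addn1.
  apply: runs_straight => //=.
  rewrite /incr /set /= ta ga //.
  case e: (adj j i) => /=; rewrite /Inv /graph_in /sample_in /update /=;
    rewrite gn tj ta ?ts ?ti ?addn1 ?addnn ?sx // e; split=> //; lia.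
- by move=> t [[gn _] _ tj _ _] /=; rewrite tj gn addn1 ltnn.
Qed.

(** Arrays below 16 hold the input, the scalars and the current sample; leaving them alone is what
    allows a body to be plugged into the loops. *)
Record cell_action (F : bool -> cell -> cell) (body : cmd) : Prop := CellAction {
  action_straight : straight body;
  action_nwrites : forall X, (X < 16)%N -> X \notin nwrites body;
  action_draws : ~~ draws body;
  action_cell : forall s (b : bool) g, nmem s a_x (nmem s v_i 0) = b ->
    cell_at (effect body s) g =
    if g == nmem s v_idx 0 then F b (cell_at s g) else cell_at s g }.

Definition node_loop_cost body := (n * (n * 10 + cost body + 21) + 5)%N.

Lemma node_loop_runs F body s x : cell_action F body -> graph_in s -> sample_in s x ->
  runs (node_loop body) s (node_loop_cost body) (fun s' =>
    nmem s' v_off 0 = offset n adj n /\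
    forall g, cell_at s' g = visit n adj F x g n (cell_at s g)).
Proof.
move=> [sb wb _ cb] gr sx.
pose Inv i s' := [/\ graph_in s', sample_in s' x, nmem s' v_i 0 = i,
  nmem s' v_off 0 = offset n adj i &
  forall g, cell_at s' g = visit n adj F x g i (cell_at s g)].
pose K := (cost node_init + ((n * 10).+1 + cost (node_end body)).+1).+1.
apply: (@runs_weaken R smp coin _ _
  (cost (Seq (set v_i (NConst 0)) (set v_off (NConst 0))) + (n * K.+1).+1).+1 _ (Inv n)).
- by rewrite /node_loop_cost /K /=; lia.
- by move=> s' [].
apply: runs_seq; apply: runs_straight => //.
apply: runs_while; last by split.
- move=> i {gr sx} t ilt [[gn ga] sx ti toff tc]; split; first by rewrite /= ti gn addn1.
  apply: runs_seq; apply: runs_straight => //; apply: runs_seq.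
  set t1 := effect node_init t.
  have gr1 : graph_in t1 by split; [exact: gn|exact: ga].
  have init1 : [/\ nmem t1 v_j 0 = 0%N, nmem t1 v_size 0 = 1%N, nmem t1 v_idx 0 = 0%N
    & nmem t1 v_addr 0 = i] by split.
  have := runs_frame (parent_loop_runs gr1 (sx : sample_in t1 x) ilt init1).
  apply: runs_weaken => // t2 [[t2s t2i] [fr _ _]].
  apply: runs_straight; first by rewrite /= sb.
  set t3 := effect (set v_idx (NAdd (get v_off) (get v_idx))) t2.
  set t4 := effect body t3.
  have fr3 X k : X \notin nwrites parent_loop -> nmem t3 X k = nmem t1 X k.
    move=> ni; rewrite -[RHS]fr // /t3 /= /update.
    by case: eqP ni => [->|].
  have fr4 X k : (X < 16)%N -> nmem t4 X k = nmem t3 X k.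
    by move=> X16; apply: (frame_nmem (effect_frame smp coin t3 sb)); exact: wb.
  have e3 : nmem t3 v_idx 0 = table_pos n adj i x.
    by rewrite /t3 /= /update /= t2i fr // [nmem t1 _ _]toff.
  have off4 : nmem t4 v_off 0 = offset n adj i by rewrite fr4 // fr3.
  have size4 : nmem t4 v_size 0 = block_size adj i n by rewrite fr4.
  have i4 : nmem t4 v_i 0 = i by rewrite fr4 // fr3.
  split.
  + split=> [|k j kn jn]; first by transitivity (nmem t4 a_n 0) => //; rewrite fr4 // fr3.
    rewrite -ga //; transitivity (nmem t4 a_adj (k + j * n)) => //; rewrite fr4 // fr3 //.
  + by move=> j jn; rewrite -sx //; transitivity (nmem t4 a_x j) => //; rewrite fr4 // fr3.
  + by rewrite [LHS]/= /update /= i4 addn1.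
  + by rewrite [LHS]/= /update /= off4 size4.
  + have x3 : nmem t3 a_x (nmem t3 v_i 0) = nth false x i.
      have -> : nmem t3 v_i 0 = i by rewrite fr3.
      by rewrite fr3 // -sx.
    move=> g; transitivity (cell_at t4 g) => //; rewrite (cb _ _ _ x3) e3.
    have -> : cell_at t3 g = cell_at t g by rewrite /cell_at !fr3.
    by rewrite tc.
- by move=> t [[gn _] _ ti _ _] /=; rewrite ti gn addn1 ltnn.
Qed.

Lemma node_loop_nwrites F body X : cell_action F body ->
  (X < 16)%N -> X \notin [:: v_i; v_j; v_addr; v_size; v_idx; v_off] ->
  X \notin nwrites (node_loop body).
Proof.
move=> [_ wb _ _] X16 ni; have nb := wb X X16.
apply: contra ni; rewrite /= !(inE, mem_cat) (negbTE nb).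
by do 6!case: (X == _).
Qed.

Lemma skip_action : cell_action (fun _ c => c) Skip.
Proof. by split=> // s b g _; rewrite if_same. Qed.

Lemma count_action : cell_action count_cell count_body.
Proof.
split=> // [X X16|s b g _]; first by rewrite inE; apply: contraTN X16 => /eqP ->.
by rewrite /cell_at /= /update /= addn1; case: eqP => [->|].
Qed.

Lemma read_action : cell_action read_cell read_body.
Proof.
split=> // [X X16|s b g xb].
  by rewrite !inE negb_or; apply/andP; split; apply: contraTN X16 => /eqP ->.
rewrite /cell_at /read_cell /= addn1.
by case: ifP => lt; rewrite /= /update /=; case: eqP => [->|] //=; rewrite lt ?addn1 ?xb.
Qed.

Definition sample_loop_cost M body := (M * (node_loop_cost body + 10) + 5)%N.

Lemma sample_loop_runs F body number M d s : cell_action F body -> graph_in s ->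
  drawn s = d -> nmem s v_off 0 = offset n adj n ->
  (forall t : state R, nmem t v_m 0 = nmem s v_m 0 -> neval t number = M) ->
  (forall k, (d <= k < d + M)%N -> size (smp k) = n) ->
  runs (sample_loop number body) s (sample_loop_cost M body) (fun s' =>
    [/\ graph_in s', drawn s' = (d + M)%N, nmem s' v_off 0 = offset n adj n &
    forall g, cell_at s' g =
      visit_all n adj F g (cell_at s g) [seq smp k | k <- iota d M]]).
Proof.
move=> act gr dr0 off0 num sz.
pose Inv k t := [/\ graph_in t, nmem t v_m 0 = nmem s v_m 0, nmem t v_s 0 = k,
  drawn t = (d + k)%N /\ nmem t v_off 0 = offset n adj n &
  forall g, cell_at t g =
    visit_all n adj F g (cell_at s g) [seq smp k | k <- iota d k]].
pose K := (1 + (node_loop_cost body + 1).+1).+1.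
apply: (@runs_weaken R smp coin _ _ (1 + (M * K.+1).+1).+1 _ (Inv M)).
- by rewrite /sample_loop_cost /K; lia.
- by move=> t [? ? ? [? ?] ?].
apply: runs_seq; apply: runs_straight => //.
apply: runs_while; last by split=> //; rewrite addn0.
- move=> k t kM [[gn ga] tm ts [td toff] tc].
  split; first by rewrite /= (num t tm) ts addn1.
  apply: runs_seq; apply: runs_straight => //; apply: runs_seq.
  set t1 := effect _ t.
  have gr1 : graph_in t1 by split; [exact: gn|exact: ga].
  have szk : size (smp (d + k)) = n by apply: sz; lia.
  have sx1 : sample_in t1 (smp (d + k)).
    by move=> j jn; rewrite /t1 /= /write_bits /= td add0n szk jn subn0.
  have := runs_frame (node_loop_runs act gr1 sx1).
  apply: runs_weaken => // t2 [[t2o t2c] [fr _ frd]].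
  have fr2 X j : (X < 16)%N -> X \notin [:: v_i; v_j; v_addr; v_size; v_idx; v_off] ->
      nmem t2 X j = nmem t1 X j.
    by move=> X16 ni; apply: fr; exact: node_loop_nwrites act X16 ni.
  apply: runs_straight => //; split.
  + by split=> [|i j il jl]; [rewrite [LHS]fr2|rewrite -ga // [LHS]fr2].
  + by rewrite [LHS]fr2.
  + by rewrite [LHS]/= /update /= fr2 // [nmem t1 _ _]ts addn1.
  + split; last exact: t2o.
    rewrite addnS -td; apply: frd.
    by case: act => _ _ nd _; rewrite /= (negbTE nd).
  + move=> g; rewrite [LHS]t2c [cell_at t1 g]tc.
    by rewrite -addn1 iotaD map_cat /visit_all foldl_cat.
- by move=> t [_ tm ts _ _] /=; rewrite (num t tm) ts addn1 ltnn.
Qed.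

Lemma tau_loop_runs s D t : nmem s v_off 0 = D ->
  (forall j, (j < t)%N -> 2 ^ j < D)%N -> (D <= 2 ^ t)%N ->
  runs tau_loop s (t * 5 + 6) (fun s' => nmem s' v_tau 0 = (7 + t)%N).
Proof.
move=> off lt ge.
pose Inv j (u : state R) := [/\ nmem u v_off 0 = D, nmem u v_pow 0 = (2 ^ j)%N
  & nmem u v_tau 0 = (7 + j)%N].
apply: (@runs_weaken R smp coin _ _ (3 + (t * 4).+1).+1 _ (Inv t)).
- by lia.
- by move=> u [].
apply: runs_seq; apply: runs_straight => //.
apply: runs_while; last by split.
- move=> j u jt [uo up ut]; split; first by rewrite /= up uo addn1 lt.
  apply: runs_straight => //; split; first exact: uo.
    by rewrite /= /update /= up addnn -mul2n -expnS.
  by rewrite [LHS]/= /update /= ut addn1.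
- by move=> u [uo up ut] /=; rewrite up uo addn1 -leqNgt.
Qed.

Lemma m_loop_runs s D eps m : nmem s v_off 0 = D -> rmem s 0 0 = eps ->
  (forall j, (32 * 1000) ^+ 2 * D%:R <= (j%:R * (eps * eps)) ^+ 2 <-> (m <= j)%N) ->
  runs m_loop s (m * 5 + 6) (fun s' => nmem s' v_m 0 = m).
Proof.
move=> off re lt.
pose Inv j (u : state R) := [/\ nmem u v_off 0 = D, rmem u 0 0 = eps & nmem u v_m 0 = j].
apply: (@runs_weaken R smp coin _ _ (1 + (m * 2).+1).+1 _ (Inv m)).
- by lia.
- by move=> u [].
apply: runs_seq; apply: runs_straight => //.
have cond j u : Inv j u -> reflect (m <= j)%N (beval u (BLeR
   (RMul (RMul r_scale r_scale) (RNat (get v_off))) (RMul r_meps r_meps))).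
  move=> [uo ue um]; rewrite [beval _ _]/= uo ue um.
  by apply: (iffP idP); rewrite -!expr2 => /lt.
apply: runs_while; last by split.
- move=> j u jt uI; split.
    by apply/negP => /(cond j u uI); rewrite leqNgt jt.
  case: uI => uo ue um.
  by apply: runs_straight => //; split=> //; rewrite [LHS]/= /update /= um addn1.
- by move=> u uI; rewrite [beval _ _]/= negbK; apply/(cond m u uI).
Qed.

Definition cell_ok tau (c : cell) := (tau <= c.1.1)%N && (c.1.1 <= c.1.2)%N.

Definition cell_stat (q : R) (c : cell) : R :=
  ((c.2%:R - c.1.1%:R * q) ^+ 2 - c.2%:R * (1 - 2 * q) - c.1.1%:R * q ^+ 2)
  / (c.1.1%:R * (q * (1 - q))).

Lemma stat_loop_runs s D tau : nmem s v_off 0 = D -> nmem s v_tau 0 = tau ->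
  runs stat_loop s (D * 10 + 10) (fun s' =>
    nmem s' a_out 0 = all (fun g => cell_ok tau (cell_at s g)) (iota 0 D) /\
    rmem s' 2 0 = \sum_(0 <= g < D) cell_stat (rmem s 1 g) (cell_at s g)).
Proof.
move=> off st.
pose Inv j (u : state R) := [/\ nmem u v_off 0 = D, nmem u v_tau 0 = tau, nmem u v_g 0 = j,
  (forall g, rmem u 1 g = rmem s 1 g /\ cell_at u g = cell_at s g) &
  nmem u a_out 0 = all (fun g => cell_ok tau (cell_at s g)) (iota 0 j) /\
  rmem u 2 0 = \sum_(0 <= g < j) cell_stat (rmem s 1 g) (cell_at s g)].
apply: (@runs_weaken R smp coin _ _ (5 + (D * 8).+1).+1 _ (Inv D)).
- by lia.
- by move=> u [].
apply: runs_seq; apply: runs_straight => //.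
apply: runs_while; last by split=> //; rewrite big_geq.
- move=> j u jD [uo ut ug uq [ua us]]; split; first by rewrite /= ug uo addn1.
  apply: (@runs_weaken R smp coin _ _ (cost stat_body) _ (Inv j.+1)) => //.
  apply: runs_straight => //.
  have [qj] := uq j; rewrite /cell_at => - [Nj Mj Yj].
  rewrite /Inv [effect _ _]/= ut ug Nj Mj.
  set ok := (_ && _).
  have okE : ok = cell_ok tau (cell_at s j) by [].
  have aE : all (fun g => cell_ok tau (cell_at s g)) (iota 0 j.+1) =
      all (fun g => cell_ok tau (cell_at s g)) (iota 0 j) && ok.
    by rewrite -addn1 iotaD all_cat /= andbT okE.
  have sE : rmem u 2 0 + reval u r_term =
      \sum_(0 <= g < j.+1) cell_stat (rmem s 1 g) (cell_at s g).
    rewrite big_nat_recr //= -us ug qj Nj Yj /cell_stat /cell_at /= -!expr2.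
    by rewrite mulr1n.
  rewrite aE -sE {aE sE okE}; case: ok => /=; rewrite /update /= ?andbT ?andbF ?ug ?addn1;
    split=> //; split=> //; rewrite ?ug //.
- by move=> u [uo ut ug _ _] /=; rewrite ug uo addn1 ltnn.
Qed.

Definition final_cell m g :=
  visit_all n adj read_cell g
    (visit_all n adj count_cell g (0, 0, 0)%N [seq smp k | k <- iota 0 m])
    [seq smp k | k <- iota m (3 * m)].

Definition verdict (q : nat -> R) (eps : R) (m tau : nat) : bool :=
  all (fun g => cell_ok tau (final_cell m g)) (iota 0 (offset n adj n)) &&
  (64 * (\sum_(0 <= g < offset n adj n) cell_stat (q g) (final_cell m g))
   <= m%:R * (eps * eps)).

Definition main_cost m t :=
  (node_loop_cost Skip + t * 5 + m * 5 + sample_loop_cost m count_body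
   + sample_loop_cost (3 * m) read_body + offset n adj n * 10 + 50)%N.

Lemma tester_main_runs s eps m t : graph_in s ->
  (forall j, nmem s a_x j = 0%N) -> (forall g, cell_at s g = (0, 0, 0)%N) ->
  drawn s = 0%N -> rmem s 0 0 = eps ->
  (forall j, (j < t)%N -> 2 ^ j < offset n adj n)%N -> (offset n adj n <= 2 ^ t)%N ->
  (forall j, (32 * 1000) ^+ 2 * (offset n adj n)%:R <= (j%:R * (eps * eps)) ^+ 2
     <-> (m <= j)%N) ->
  (forall k, (k < m + 3 * m)%N -> size (smp k) = n) ->
  runs tester_main s (main_cost m t) (fun s' =>
    drawn s' = (m + 3 * m)%N /\
    nmem s' a_out 0 = verdict (rmem s 1) eps m (7 + t)).
Proof.
move=> gr x0 c0 dr0 eps0 tlt tge mP sz.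
(* The first pass over the nodes precedes any draw and serves to compute D in [v_off]; the zeroed
   sample array is viewed as the empty sample. *)
have sx : sample_in s [::] by move=> j _; rewrite x0 nth_nil.
set D := offset n adj n in tlt tge mP *.
have := @runs_weaken R smp coin tester_main s (node_loop_cost Skip + ((t * 5 + 6) +
  ((m * 5 + 6) + (sample_loop_cost m count_body + (sample_loop_cost (3 * m) read_body +
  ((D * 10 + 10) + 3).+1).+1).+1).+1).+1).+1 (main_cost m t); apply.
- by rewrite /main_cost /D; lia.
- by move=> s' h; exact: h.
apply: runs_seq; have := runs_frame (node_loop_runs skip_action gr sx).
apply: runs_weaken => // s1 [[off1 c1] [fr1 fq1 fd1]].
have n1 X j : X \notin nwrites (node_loop Skip) -> nmem s1 X j = nmem s X j by exact: fr1.
have visit_skip g k c : visit n adj (fun _ c => c) [::] g k c = c.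
  by elim: k => //= k ->; rewrite if_same.
have {visit_skip}c1 g : cell_at s1 g = (0, 0, 0)%N by rewrite c1 visit_skip.
have {n1}gr1 : graph_in s1 by case: gr => gn ga; split=> [|i j il jl]; rewrite n1 // ga.
apply: runs_seq; have := runs_frame (tau_loop_runs off1 tlt tge).
apply: runs_weaken => // s2 [tau2 [fr2 fq2 fd2]].
have {gr1}gr2 : graph_in s2.
  by case: gr1 => gn ga; split=> [|i j il jl]; rewrite fr2 // ga.
have off2 : nmem s2 v_off 0 = D by rewrite fr2.
have eps2 : rmem s2 0 0 = eps by rewrite fq2 // fq1.
apply: runs_seq; have := runs_frame (m_loop_runs off2 eps2 mP).
apply: runs_weaken => // s3 [m3 [fr3 fq3 fd3]].
have {gr2}gr3 : graph_in s3.
  by case: gr2 => gn ga; split=> [|i j il jl]; rewrite fr3 // ga.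
have off3 : nmem s3 v_off 0 = D by rewrite fr3.
have dr3 : drawn s3 = 0%N by rewrite fd3 // fd2 // fd1.
have c3 g : cell_at s3 g = (0, 0, 0)%N by rewrite -(c1 g) /cell_at !fr3 // !fr2.
have num3 (u : state R) : nmem u v_m 0 = nmem s3 v_m 0 -> neval u (get v_m) = m.
  by rewrite m3.
have sz3 k : (0 <= k < 0 + m)%N -> size (smp k) = n by move=> h; apply: sz; lia.
apply: runs_seq.
have := runs_frame (sample_loop_runs count_action gr3 dr3 off3 num3 sz3).
apply: runs_weaken => // s4 [[gr4 dr4 off4 c4] [fr4 fq4 _]].
have m4 : nmem s4 v_m 0 = m by rewrite fr4.
have num4 (u : state R) : nmem u v_m 0 = nmem s4 v_m 0 ->
    neval u (NAdd (get v_m) (NAdd (get v_m) (get v_m))) = (3 * m)%N.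
  by rewrite m4 /= => ->; lia.
have sz4 k : (m <= k < m + 3 * m)%N -> size (smp k) = n by move=> h; apply: sz; lia.
apply: runs_seq.
have := runs_frame (sample_loop_runs read_action gr4 dr4 off4 num4 sz4).
apply: runs_weaken => // s5 [[gr5 dr5 off5 c5] [fr5 fq5 _]].
have tau5 : nmem s5 v_tau 0 = (7 + t)%N by rewrite fr5 // fr4 // fr3.
apply: runs_seq; have := runs_frame (stat_loop_runs off5 tau5).
apply: runs_weaken => // s6 [[out6 st6] [fr6 fq6 fd6]].
have cE g : cell_at s5 g = final_cell m g by rewrite c5 c4 c3.
have qE g : rmem s5 1 g = rmem s 1 g by rewrite fq5 // fq4 // fq3 // fq2 // fq1.
have eps6 : rmem s6 0 0 = eps by rewrite fq6 // fq5 // fq4 // fq3.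
have m6 : nmem s6 v_m 0 = m by rewrite fr6 // fr5.
apply: runs_straight => //; rewrite /verdict -/D.
have -> : all (fun g => cell_ok (7 + t) (final_cell m g)) (iota 0 D) = (nmem s6 a_out 0 != 0%N).
  rewrite out6 eqb0 negbK; apply: eq_all => g; by rewrite cE.
have -> : \sum_(0 <= g < D) cell_stat (rmem s 1 g) (final_cell m g) = rmem s6 2 0.
  by rewrite st6; apply: eq_bigr => g _; rewrite cE qE.
rewrite [effect _ _]/= m6 eps6; split.
  by case: ifP => _ /=; rewrite fd6.
case: ifP => _; rewrite ?andbT ?andbF //.
by rewrite out6 eqb0 negbK.
Qed.

End TesterCorrect.

(** * Factorization of Bayes nets *)

Section BayesFactorization.
Variables (R : realType) (n : nat) (S : rel 'I_n).
Hypothesis S_sorted : topsorted S.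
Variable P : cube n -> R.
Hypothesis PB : bayes_net S P.

Lemma Pr_ge0 (E : pred (cube n)) : 0 <= Pr P E.
Proof. by case: PB => -[P0 _] _; exact: sumr_ge0. Qed.

Lemma Pr_eq (E F : pred (cube n)) : E =1 F -> Pr P E = Pr P F.
Proof. exact: eq_bigl. Qed.

Lemma Pr_le (E F : pred (cube n)) : (forall x, E x -> F x) -> Pr P E <= Pr P F.
Proof.
case: PB => -[P0 _] _ EF; rewrite /Pr [leRHS](bigID E) /=.
rewrite (eq_bigl E) => [|x]; last by case: (boolP (E x)) => [/EF ->|]; rewrite ?andbF.
by rewrite lerDl sumr_ge0.
Qed.

(** Holds on null events too, as both sides then vanish. *)
Lemma condPr_mul (E F : pred (cube n)) :
  condPr P E F * Pr P F = Pr P [predI E & F].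
Proof.
have [F0|F0] := eqVneq (Pr P F) 0; last by rewrite divfK.
rewrite F0 mulr0; apply/esym/eqP; rewrite eq_le Pr_ge0 andbT -F0.
by apply: Pr_le => x /andP[].
Qed.

Lemma condPr_itv (E F : pred (cube n)) : 0 <= condPr P E F <= 1.
Proof.
rewrite /condPr divr_ge0 ?Pr_ge0 //=.
have [F0|F0] := eqVneq (Pr P F) 0; first by rewrite F0 invr0 mulr0 ler01.
have Fp : 0 < Pr P F by rewrite lt_neqAle eq_sym F0 Pr_ge0.
by rewrite ler_pdivrMr // mul1r; apply: Pr_le => x /andP[].
Qed.

Lemma config_marginal i a b :
  \sum_(x | parent_config S i a x && (x i == b)) P x =
  Pr P (parent_config S i a) * bern (cond_param S P i a) b.
Proof.
have t1 : \sum_(x | parent_config S i a x && (x i == true)) P x =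
    Pr P (parent_config S i a) * cond_param S P i a.
  by rewrite mulrC condPr_mul; apply: eq_bigl => x /=; rewrite eqb_id andbC.
case: b => /=; first exact: t1.
rewrite mulrBr mulr1 -t1 /Pr [in RHS](bigID (fun x : cube n => x i == true)) /=.
by rewrite addrC addrK; apply: eq_bigl => x; case: (x i).
Qed.

Lemma same_prefix_config (i : 'I_n) x y :
  same_prefix i x y -> parent_values S i y = parent_values S i x.
Proof.
move=> /forallP sp; apply/eq_in_map => j; rewrite mem_enum inE => /S_sorted ji.
by have := sp j; rewrite ji => /eqP.
Qed.

(** A canonical member of the prefix class of [x], so that sums can be partitioned by class. *)
Definition prefix_rep (i : 'I_n) (x : cube n) : cube n :=
  [ffun j : 'I_n => if (j < i)%N then x j else false].

Lemma prefix_repP (i : 'I_n) x y :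
  same_prefix i x y = (prefix_rep i y == prefix_rep i x).
Proof.
apply/forallP/eqP => [sp|e j]; first last.
  by apply/implyP => ji; have := congr1 (fun f : cube n => f j) e; rewrite !ffunE ji => ->.
apply/ffunP => j; rewrite !ffunE; case: ifP => // ji.
by have := sp j; rewrite ji => /eqP.
Qed.

(** As parents precede [i], a parental configuration is a disjoint union of prefix classes. They
    share one conditional probability, except null classes, which contribute 0; averaging gives the
    same value. *)
Lemma cond_param_prefix (i : 'I_n) x : 0 < Pr P (same_prefix i x) ->
  condPr P (coord_true i) (same_prefix i x) =
  cond_param S P i (parent_values S i x).
Proof.
case: PB => PD PI px; set r := condPr _ _ _; set a := parent_values S i x.
have pa : 0 < Pr P (parent_config S i a).
  apply: lt_le_trans px _; apply: Pr_le => y; rewrite /parent_config => sp.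
  by rewrite (same_prefix_config sp).
suff e : Pr P [predI coord_true i & parent_config S i a] =
    r * Pr P (parent_config S i a).
  by rewrite /cond_param /condPr e mulfK // gt_eqF.
rewrite /Pr (partition_big (prefix_rep i) xpredT) //=.
rewrite [in RHS](partition_big (prefix_rep i) xpredT) //= mulr_sumr.
apply: eq_bigr => z _.
have [y /andP[ya /eqP yz]|no] := pickP
    (fun y => parent_config S i a y && (prefix_rep i y == z)); last first.
  rewrite big_pred0 => [|y]; last by rewrite /= -andbA; have /= -> := no y; rewrite andbF.
  by rewrite big_pred0 ?mulr0 // => y; have /= -> := no y.
have cls : (fun w => parent_config S i a w && (prefix_rep i w == z)) =1 same_prefix i y.
  move=> w; rewrite prefix_repP yz; case: eqP => [wz|]; rewrite ?andbF ?andbT //.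
  rewrite /parent_config (same_prefix_config (x := y)) //.
  by rewrite prefix_repP yz wz.
transitivity (Pr P [predI coord_true i & same_prefix i y]).
  by apply: eq_bigl => w /=; rewrite -andbA; congr (_ && _); exact: cls.
rewrite (eq_bigl _ _ cls) -/(Pr P (same_prefix i y)) -condPr_mul.
have [y0|y0] := eqVneq (Pr P (same_prefix i y)) 0; first by rewrite y0 !mulr0.
congr (_ * _); apply/esym/PI => //; first by rewrite lt_neqAle eq_sym y0 Pr_ge0.
by rewrite (eqP ya).
Qed.

(** [same_prefix] with a natural number as length, so that [k = n] is allowed. *)
Definition prefix_event (k : nat) (x : cube n) : pred (cube n) :=
  fun y => [forall j : 'I_n, (j < k)%N ==> (y j == x j)].

(** Chain rule; after a null prefix, the longer prefix is null as well and both sides are 0. *)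
Lemma prefix_chain k x : (k <= n)%N ->
  Pr P (prefix_event k x) =
  \prod_(i < n | (i < k)%N) bern (cond_param S P i (parent_values S i x)) (x i).
Proof.
elim: k => [_|k IH kn].
  rewrite big_pred0 //; case: PB => -[_ P1] _; rewrite -[RHS]P1.
  by apply: eq_bigl => y; apply/forallP => j.
pose i0 := Ordinal kn.
rewrite (bigD1 i0) //= (eq_bigl (fun i : 'I_n => (i < k)%N)) => [|i]; last first.
  by rewrite ltnS [in RHS]ltn_neqAle andbC -(inj_eq val_inj).
rewrite -IH; last exact: ltnW.
have split y : prefix_event k.+1 x y = prefix_event k x y && (y i0 == x i0).
  apply/forallP/andP => [al|[/forallP al yx] j].
    split; last by have := al i0; rewrite /= ltnSn.
    apply/forallP => j; apply/implyP => jk.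
    by have := al j; rewrite ltnS ltnW.
  rewrite ltnS leq_eqVlt; apply/implyP => /orP[/eqP jk|jk].
    by have -> : j = i0 by exact: val_inj.
  by have := al j; rewrite jk.
rewrite (Pr_eq split).
have PE : Pr P (prefix_event k x) = Pr P (same_prefix i0 x) by [].
have [z|nz] := eqVneq (Pr P (prefix_event k x)) 0.
  rewrite z mulr0; apply/eqP; rewrite eq_le Pr_ge0 andbT -z.
  by apply: Pr_le => y /andP[].
have pos : 0 < Pr P (same_prefix i0 x) by rewrite lt_neqAle eq_sym -PE nz Pr_ge0.
rewrite -(cond_param_prefix pos) PE.
have t1 := condPr_mul (coord_true i0) (same_prefix i0 x).
case xi : (x i0) => /=.
  by rewrite t1; apply: Pr_eq => y /=; rewrite andbC /coord_true eqb_id.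
have e : Pr P (same_prefix i0 x) = Pr P [predI coord_true i0 & same_prefix i0 x] +
    Pr P (fun y => prefix_event k x y && (y i0 == false)).
  rewrite {1}/Pr (bigID (fun y : cube n => y i0)) /=; congr (_ + _).
    by apply: eq_bigl => y; rewrite /= andbC.
  by apply: eq_bigl => y; rewrite eqbF_neg.
by rewrite mulrBl mul1r t1 e addrC addKr.
Qed.

Lemma bayes_net_prod x :
  P x = \prod_(i < n) bern (cond_param S P i (parent_values S i x)) (x i).
Proof.
have := prefix_chain x (leqnn n); rewrite (eq_bigl xpredT) => [<-|i]; last exact: ltn_ord.
rewrite /Pr (big_pred1 x) // => y; apply/forallP/eqP => [al|-> j]; last by rewrite eqxx implybT.
by apply/ffunP => j; have := al j; rewrite ltn_ord => /eqP.
Qed.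

End BayesFactorization.

(** * Layout of the table of parameters *)

(** Binary value with the most significant bit first, that is, the rank of [s] in [all_bits]. *)
Definition lex (s : bitseq) : nat := foldl (fun a (b : bool) => a.*2 + b)%N 0%N s.

Lemma lex_cons b s : lex (b :: s) = (b * 2 ^ size s + lex s)%N.
Proof.
suff h a : foldl (fun a (b : bool) => a.*2 + b)%N a s = (a * 2 ^ size s + lex s)%N.
  by rewrite /lex /= h.
rewrite /lex; elim: s a => [|c s IH] a /=; first by rewrite muln1 addn0.
by rewrite IH [in RHS]IH expnS -muln2; lia.
Qed.

Lemma size_all_bits k : size (all_bits k) = (2 ^ k)%N.
Proof. by elim: k => //= k IH; rewrite size_cat !size_map IH addnn -mul2n expnS. Qed.

Lemma all_bits_lexK k s : size s = k ->
  (lex s < 2 ^ k)%N /\ nth [::] (all_bits k) (lex s) = s.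
Proof.
elim: k s => [|k IH] [|b s] //= [sk]; have [lt eq] := IH s sk.
rewrite lex_cons sk nth_cat size_map size_all_bits expnS.
case: b => /=; rewrite ?mul1n ?mul0n ?add0n.
  rewrite ifF; last by apply/negbTE; rewrite -leqNgt leq_addr.
  by rewrite addKn (nth_map [::]) ?size_all_bits // eq; split=> //; lia.
rewrite lt (nth_map [::]) ?size_all_bits // eq; split=> //; lia.
Qed.

Lemma lex_all_bitsK k r : (r < 2 ^ k)%N ->
  size (nth [::] (all_bits k) r) = k /\ lex (nth [::] (all_bits k) r) = r.
Proof.
elim: k r => [|k IH] r /=; first by case: r.
rewrite expnS nth_cat size_map size_all_bits => r2.
case: ltnP => rk.
  have [sz e] := IH r rk.
  by rewrite (nth_map [::]) ?size_all_bits // lex_cons /= sz e mul0n.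
have rk' : (r - 2 ^ k < 2 ^ k)%N by lia.
have [sz e] := IH _ rk'.
by rewrite (nth_map [::]) ?size_all_bits // lex_cons /= sz e mul1n subnKC.
Qed.

Section TableLayout.
Variables (n : nat) (S : rel 'I_n).
Hypothesis S_sorted : topsorted S.

Definition nat_adj (j i : nat) : bool :=
  if (insub j, insub i) is (Some a, Some b) then S a b else false.

Lemma nat_adj_ord (a b : 'I_n) : nat_adj a b = S a b.
Proof. by rewrite /nat_adj !valK. Qed.

Lemma nth_sample_bits (x : cube n) (j : 'I_n) : nth false (sample_bits x) j = x j.
Proof. by rewrite (nth_map j) ?size_enum_ord // nth_ord_enum. Qed.

Lemma size_sample_bits (x : cube n) : size (sample_bits x) = n.
Proof. by rewrite size_map size_enum_ord. Qed.

Lemma filter_parents (i : 'I_n) :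
  [seq k <- iota 0 n | nat_adj k i] = [seq val k | k <- enum (parents S i)].
Proof.
rewrite -val_enum_ord filter_map; congr map; rewrite enumT.
apply: eq_filter => k /=; by rewrite nat_adj_ord -[RHS]/(k \in parents S i) inE.
Qed.

Lemma block_sizeE (i : 'I_n) : block_size nat_adj i n = (2 ^ #|parents S i|)%N.
Proof.
have h k : block_size nat_adj i k = (2 ^ size [seq j <- iota 0 k | nat_adj j i])%N.
  elim: k => // k IH; rewrite -addn1 iotaD filter_cat size_cat addn1 /= IH add0n.
  by case: ifP => _ /=; rewrite ?addn0 ?addn1 ?expnS ?mul2n.
by rewrite h filter_parents size_map -cardE.
Qed.

Lemma block_indexE (i : 'I_n) (x : cube n) :
  block_index nat_adj i (sample_bits x) n = lex (parent_values S i x).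
Proof.
have h k : block_index nat_adj i (sample_bits x) k =
    lex [seq nth false (sample_bits x) j | j <- iota 0 k & nat_adj j i].
  elim: k => // k IH; rewrite -addn1 iotaD filter_cat map_cat /lex foldl_cat addn1 /= add0n IH.
  by case: ifP.
rewrite h filter_parents -map_comp; congr lex; apply: eq_map => j /=.
exact: nth_sample_bits.
Qed.

Definition block_sizes := [seq (2 ^ #|parents S i|)%N | i <- enum 'I_n].

Lemma size_block_sizes : size block_sizes = n.
Proof. by rewrite size_map size_enum_ord. Qed.

Definition table_size := offset n nat_adj n.

Lemma offsetE k : (k <= n)%N -> offset n nat_adj k = sumn (take k block_sizes).
Proof.
elim: k => [|k IH] kn; first by rewrite take0.
rewrite [LHS]/= (take_nth 0%N) ?size_block_sizes // sumn_rcons IH 1?ltnW //; congr addn.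
rewrite (nth_map (Ordinal kn)) ?size_enum_ord //.
by rewrite -[X in nth _ _ X]/(nat_of_ord (Ordinal kn)) nth_ord_enum -block_sizeE.
Qed.

Lemma table_sizeE : table_size = sumn block_sizes.
Proof. by rewrite /table_size offsetE // take_oversize // size_block_sizes. Qed.

Lemma nth_block_sizes (i : 'I_n) : nth 0%N block_sizes i = (2 ^ #|parents S i|)%N.
Proof. by rewrite (nth_map i) ?size_enum_ord // nth_ord_enum. Qed.

Lemma table_posE (i : 'I_n) (x : cube n) :
  table_pos n nat_adj i (sample_bits x) =
  flatten_index block_sizes i (lex (parent_values S i x)).
Proof. by rewrite /table_pos offsetE 1?ltnW // block_indexE. Qed.

Lemma size_parent_values i (x : cube n) : size (parent_values S i x) = #|parents S i|.
Proof. by rewrite size_map -cardE. Qed.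

Lemma lex_parent_values_lt i (x : cube n) :
  (lex (parent_values S i x) < nth 0 block_sizes i)%N.
Proof.
by rewrite nth_block_sizes; have [] := all_bits_lexK (size_parent_values i x).
Qed.

Lemma pos_lt (i : 'I_n) (x : cube n) :
  (table_pos n nat_adj i (sample_bits x) < table_size)%N.
Proof.
rewrite table_posE table_sizeE; apply: flatten_indexP; exact: lex_parent_values_lt.
Qed.

Definition pos (i : 'I_n) (x : cube n) : 'I_table_size := Ordinal (pos_lt i x).

Lemma owner_lt (g : 'I_table_size) : (reshape_index block_sizes g < n)%N.
Proof.
have := @reshape_indexP block_sizes g; rewrite size_block_sizes; apply.
by rewrite -table_sizeE.
Qed.

Definition owner (g : 'I_table_size) : 'I_n := Ordinal (owner_lt g).

Definition config (g : 'I_table_size) : bitseq :=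
  nth [::] (all_bits #|parents S (owner g)|) (reshape_offset block_sizes g).

Lemma owner_pos i x : owner (pos i x) = i.
Proof.
apply: val_inj; rewrite /= table_posE; apply: flatten_indexKl.
exact: lex_parent_values_lt.
Qed.

Lemma offset_lt (g : 'I_table_size) :
  (reshape_offset block_sizes g < 2 ^ #|parents S (owner g)|)%N.
Proof.
rewrite -nth_block_sizes; apply: reshape_offsetP; by rewrite -table_sizeE.
Qed.

Lemma size_config g : size (config g) = #|parents S (owner g)|.
Proof. by have [] := lex_all_bitsK (offset_lt g). Qed.

Lemma config_pos i x : config (pos i x) = parent_values S i x.
Proof.
rewrite /config owner_pos /= table_posE flatten_indexKr; last exact: lex_parent_values_lt.
by have [] := all_bits_lexK (size_parent_values i x).
Qed.

Lemma hit_config g x : hit pos owner g x = parent_config S (owner g) (config g) x.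
Proof.
apply/eqP/eqP => [<-|e].
  by rewrite config_pos owner_pos.
apply: val_inj; have -> : val (pos (owner g) x) = _ := table_posE (owner g) x.
rewrite e; have [_ ->] := lex_all_bitsK (offset_lt g).
exact: reshape_indexK.
Qed.

Lemma pos_prefix (i : 'I_n) (x y : cube n) :
  (forall j : 'I_n, (j < i)%N -> x j = y j) -> pos i x = pos i y.
Proof.
move=> xy; apply: val_inj; rewrite /= !table_posE; congr (flatten_index _ _ (lex _)).
by apply/eq_in_map => j; rewrite mem_enum inE => /S_sorted /xy.
Qed.

Definition param (R : realType) (P : cube n -> R) (g : 'I_table_size) : R :=
  cond_param S P (owner g) (config g).

Lemma table_nth (R : realType) (P : cube n -> R) (g : 'I_table_size) :
  nth 0 (flatten [seq [seq cond_param S P i a | a <- all_bits #|parents S i|]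
                 | i <- enum 'I_n]) g = param P g.
Proof.
rewrite nth_flatten.
have -> : shape [seq [seq cond_param S P i a | a <- all_bits #|parents S i|]
                 | i <- enum 'I_n] = block_sizes.
  by rewrite /shape -map_comp; apply: eq_map => i /=; rewrite size_map size_all_bits.
rewrite (nth_map (owner g)) ?size_enum_ord ?owner_lt //.
rewrite -[reshape_index _ _]/(nat_of_ord (owner g)) nth_ord_enum.
by rewrite (nth_map [::]) // size_all_bits offset_lt.
Qed.

Lemma bayes_net_factorizes (R : realType) (P : cube n -> R) :
  bayes_net S P -> factorizes pos P (param P).
Proof.
move=> PB; split=> [g|x]; first exact: condPr_itv PB _ _.
rewrite (bayes_net_prod S_sorted PB); apply: eq_bigr => i _.
by rewrite /param owner_pos config_pos.
Qed.

Lemma hit_probE (R : realType) (P : cube n -> R) g :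
  hit_prob pos owner P g = Pr P (parent_config S (owner g) (config g)).
Proof. by apply: eq_bigl => x; exact: hit_config. Qed.

Lemma param_marginal (R : realType) (P : cube n -> R) g b : bayes_net S P ->
  \sum_(x | hit pos owner g x && (hit_bit owner g x == b)) P x =
  hit_prob pos owner P g * bern (param P g) b.
Proof.
move=> PB; rewrite hit_probE -(config_marginal PB).
by apply: eq_bigl => x; rewrite hit_config.
Qed.

Lemma table_size_ge : (n <= table_size)%N.
Proof.
rewrite table_sizeE sumnE big_map big_enum /= -[leqLHS]card_ord -sum1_card.
by apply: leq_sum => i _; rewrite expn_gt0.
Qed.

Lemma table_size_le : (table_size <= n * 2 ^ max_indegree S)%N.
Proof.
rewrite table_sizeE sumnE big_map big_enum /=.
apply: (@leq_trans (\sum_(i < n) 2 ^ max_indegree S)); last by rewrite sum_nat_const card_ord.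
by apply: leq_sum => i _; rewrite leq_exp2l //; exact: leq_bigmax.
Qed.

(** Table blocks of distinct nodes are disjoint, so a sample touches cell [g] at most once, at its
    owner. *)
Lemma visit_hit F (g : 'I_table_size) (x : cube n) c :
  visit n nat_adj F (sample_bits x) g n c =
  if hit pos owner g x then F (hit_bit owner g x) c else c.
Proof.
have h k : (k <= n)%N -> visit n nat_adj F (sample_bits x) g k c =
    if hit pos owner g x && (owner g < k)%N then F (hit_bit owner g x) c else c.
  elim: k => [_|k IH kn]; first by rewrite /= ltn0 andbF.
  rewrite /= IH; last exact: ltnW.
  pose i := Ordinal kn.
  have -> : (g == table_pos n nat_adj k (sample_bits x) :> nat) =
      hit pos owner g x && (owner g == i).
    rewrite -[table_pos _ _ _ _]/(val (pos i x)) (inj_eq val_inj) /hit.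
    apply/eqP/andP => [->|[/eqP e /eqP <-]]; last exact: esym.
    by rewrite owner_pos !eqxx.
  case: (boolP (hit _ _ _ _)) => //= _; rewrite -(inj_eq val_inj) /= ltnS.
  case: ltngtP => // e; congr F.
  by rewrite /hit_bit -nth_sample_bits /= e.
by rewrite h // ltn_ord andbT.
Qed.

Lemma visit_all_count (g : 'I_table_size) ws :
  visit_all n nat_adj count_cell g (0, 0, 0)%N [seq sample_bits x | x <- ws] =
  (hits pos owner ws g, 0, 0)%N.
Proof.
suff h a : visit_all n nat_adj count_cell g (a, 0, 0)%N [seq sample_bits x | x <- ws] =
    (a + hits pos owner ws g, 0, 0)%N by rewrite h.
elim: ws a => [|x ws IH] a /=; first by rewrite addn0.
rewrite /visit_all /= visit_hit; case: ifP => _; last exact: IH.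
by rewrite -/(visit_all _ _ _ _ _ _) IH /= addnA addn1.
Qed.

Lemma visit_all_read (g : 'I_table_size) ws N :
  visit_all n nat_adj read_cell g (N, 0, 0)%N [seq sample_bits x | x <- ws] =
  (N, minn N (hits pos owner ws g), count id (take N (tape pos owner g ws))).
Proof.
suff h M Y : (M <= N)%N ->
    visit_all n nat_adj read_cell g (N, M, Y)%N [seq sample_bits x | x <- ws] =
    (N, minn N (M + hits pos owner ws g),
     (Y + count id (take (N - M) (tape pos owner g ws)))%N) by rewrite h ?subn0.
elim: ws M Y => [|x ws IH] M Y MN /=; first by rewrite addn0 (minn_idPr MN) addn0.
rewrite /visit_all /= visit_hit -/(visit_all _ _ _ _ _ _).
rewrite /hits /tape /=; case: (hit _ _ _ _) => /=; last by rewrite IH.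
rewrite /read_cell /=; case: ltnP => lt.
  rewrite IH // addnS addSn subnS; case e: (N - M)%N => [|k] /=; first by lia.
  by rewrite addnA.
rewrite IH // (_ : N - M = 0)%N ?take0 /=; last by lia.
by congr (_, _, _); lia.
Qed.

Lemma verdict_decide (R : realType) (smp : nat -> bitseq) (q : nat -> R)
    (eps : R) m tau (ws : seq (cube n)) :
  size ws = (m + 3 * m)%N ->
  (forall k, (k < m + 3 * m)%N -> smp k = nth [::] [seq sample_bits x | x <- ws] k) ->
  verdict smp n nat_adj q eps m tau =
  decide pos owner (fun g => q g) m tau eps (take m ws) (drop m ws).
Proof.
move=> sz smpE.
have E1 : [seq smp k | k <- iota 0 m] = [seq sample_bits x | x <- take m ws].
  rewrite map_take -[RHS](mkseq_nth [::]) size_take size_map sz.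
  rewrite (_ : (if _ then _ else _) = m); last by case: ltnP; lia.
  apply/eq_in_map => k; rewrite mem_iota => km; rewrite nth_take ?smpE //; lia.
have E2 : [seq smp k | k <- iota m (3 * m)] = [seq sample_bits x | x <- drop m ws].
  rewrite map_drop -[RHS](mkseq_nth [::]) size_drop size_map sz addKn.
  rewrite /mkseq -{1}[m]addn0 iotaDl -map_comp; apply/eq_in_map => k /=.
  by rewrite mem_iota => km; rewrite nth_drop smpE //; lia.
have cE (g : 'I_table_size) : final_cell smp n nat_adj m g =
    (hits pos owner (take m ws) g,
     minn (hits pos owner (take m ws) g) (hits pos owner (drop m ws) g),
     count id (take (hits pos owner (take m ws) g) (tape pos owner g (drop m ws)))).
  by rewrite /final_cell E1 E2 visit_all_count visit_all_read.
rewrite /verdict /decide -/table_size.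
have -> : all (fun g => cell_ok tau (final_cell smp n nat_adj m g)) (iota 0 table_size) =
    enough pos owner tau (hits pos owner (take m ws)) (drop m ws).
  rewrite -val_enum_ord all_map.
  apply/allP/forallP => [al g|al g _] /=.
    have := al g; rewrite mem_enum /= cE /cell_ok /= leq_min leqnn /=; exact.
  by rewrite cE /cell_ok /= leq_min leqnn.
(* The statistics are compared only under [enough], which gives the truncated tapes the exact
   lengths [N_g] used by the program's formula. *)
apply: andb_id2l => /forallP en.
rewrite -expr2; congr (64 * _ <= _); rewrite big_mkord; apply: eq_bigr => g _.
rewrite cE /cell_stat /normalized_pair_sum /= pair_sum_count size_takel //.
by rewrite size_tape; case/andP: (en g).
Qed.

End TableLayout.

(** * Sample size, running time and thresholds *)

Lemma runs_run (R : realType) (smp : nat -> bitseq) (coin : nat -> bool) prog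
    (inp : input R) K t (Post : state R -> Prop) :
  runs smp coin prog (init inp) K Post -> (K <= t)%N ->
  exists2 s', run prog inp smp coin t = ([::], s') & Post s'.
Proof.
move=> [s' [k [kK ex ps]]] Kt; exists s' => //.
by rewrite /run -(subnK (leq_trans kK Kt)) iterD ex iter_fix.
Qed.

(** When the answer does not depend on the coins, averaging over them is trivial. *)
Lemma answer_probE (R : realType) n prog (inp : input R) (P : cube n -> R) m t b
    (dec : seq (cube n) -> bool) :
  (forall (w : {ffun 'I_m -> cube n}) coin,
     accepts prog inp (stream [::] (fun j => sample_bits (w j))) coin t = dec (codom w)) ->
  answer_prob prog inp P m t b = iidE P m (fun ws => (dec ws == b)%:R).
Proof.
move=> decE; rewrite -iidE_ffun; apply: eq_bigr => w _.
under eq_bigr do rewrite decE -mulrA.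
rewrite -mulr_sumr sumr_const card_ffun card_bool card_ord; congr (_ * _).
by rewrite -[_ *+ _]mulr_natr mulrAC natrX mulVf ?mul1r // expf_neq0 // pnatr_eq0.
Qed.

Lemma nth_flatten_uniform (T : Type) (x0 : T) (ss : seq (seq T)) k i j :
  (forall l, (l < size ss)%N -> size (nth [::] ss l) = k) ->
  (i < k)%N -> (j < size ss)%N ->
  nth x0 (flatten ss) (i + j * k) = nth x0 (nth [::] ss j) i.
Proof.
elim: ss j => //= s ss IH [|j] sz ik js.
  by rewrite mul0n addn0 nth_cat (sz 0%N) // ik.
rewrite nth_cat (sz 0%N) // mulSn ltnNge addnCA leq_addr /= addKn IH //.
by move=> l ls; exact: (sz l.+1).
Qed.

Section InputSize.
Variables (R : realType) (n : nat) (S : rel 'I_n) (Q : cube n -> R) (eps : R).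

Lemma input_graph : graph_in n (nat_adj S) (init (tester_input S Q eps)).
Proof.
split=> // i j il jl; rewrite /= /tester_input /=.
have sz l : (l < size [seq [seq nat_of_bool (S a b) | b <- enum 'I_n] | a <- enum 'I_n])%N ->
    size (nth [::] [seq [seq nat_of_bool (S a b) | b <- enum 'I_n] | a <- enum 'I_n] l) = n.
  rewrite size_map size_enum_ord => ln.
  by rewrite (nth_map (Ordinal ln)) ?size_enum_ord // size_map size_enum_ord.
rewrite (nth_flatten_uniform _ sz il); last by rewrite size_map size_enum_ord.
pose a := Ordinal jl; pose b := Ordinal il.
rewrite (nth_map a) ?size_enum_ord // (nth_map b) ?size_enum_ord //.
by rewrite -[j]/(val a) -[i]/(val b) !nth_ord_enum nat_adj_ord.
Qed.

Lemma input_sizeE :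
  input_size (tester_input S Q eps) = (n * n + table_size S + 2)%N.
Proof.
rewrite /input_size /= !addn0 !size_flatten.
have -> : sumn (shape [seq [seq nat_of_bool (S j i) | i <- enum 'I_n] | j <- enum 'I_n])
    = (n * n)%N.
  rewrite /shape -map_comp sumnE big_map big_enum /=.
  under eq_bigr do rewrite size_map size_enum_ord.
  by rewrite sum_nat_const card_ord.
have -> : sumn (shape [seq [seq cond_param S Q i a | a <- all_bits #|parents S i|]
                      | i <- enum 'I_n]) = table_size S.
  rewrite table_sizeE; congr sumn; rewrite /shape -map_comp; apply: eq_map => i /=.
  by rewrite size_map size_all_bits.
lia.
Qed.

Lemma input_size_ge : (1 + n + table_size S <= input_size (tester_input S Q eps))%N.
Proof.
rewrite input_sizeE.
have : (n <= n * n)%N by case: (n) => // k; rewrite leq_pmulr.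
lia.
Qed.

End InputSize.

(** The cubic term is samples times nodes times candidate parents. *)
Lemma main_cost_le n adj m t : (t <= offset n adj n)%N ->
  ((main_cost n adj m t).+1 <= 1000 * (1 + n + offset n adj n + m) ^ 3)%N.
Proof.
set D := offset n adj n => tD; set W := (1 + n + D + m)%N.
have nW : (n <= W)%N by rewrite /W; lia.
have mW : (m <= W)%N by rewrite /W; lia.
have DW : (D <= W)%N by rewrite /W; lia.
have W1 : (1 <= W)%N by rewrite /W; lia.
have W3 : (W <= W ^ 3)%N by rewrite -[leqLHS]expn1 leq_pexp2l.
have W23 : (W * W <= W ^ 3)%N by rewrite -[(W * W)%N]/(W ^ 2)%N leq_pexp2l.
have nn : (n * n <= W ^ 3)%N by apply: leq_trans W23; exact: leq_mul.
have mn : (m * n <= W ^ 3)%N by apply: leq_trans W23; exact: leq_mul.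
have mnn : (m * (n * n) <= W ^ 3)%N by rewrite expnS; apply: leq_mul => //; exact: leq_mul.
rewrite /main_cost /sample_loop_cost /node_loop_cost /= -/D.
move: (W ^ 3)%N W3 nn mn mnn => Z; clearbody W => *.
nia.
Qed.

Section Thresholds.
Variables (R : realType).

Lemma expR_ge_exp2 k : 2 ^+ k <= expR k%:R :> R.
Proof.
rewrite -[k%:R]mulr1 expRM_natl lerXn2r ?nnegrE ?expR_ge0 //.
by have := expR_ge1Dx (1 : R); lra.
Qed.

Lemma exp2_up_log_le D : (0 < D)%N -> (2 ^ up_log 2 D <= 2 * D)%N.
Proof.
move=> D0; have [D1|D1] := leqP D 1.
  have -> : D = 1%N by lia.
  by rewrite up_log1.
have := up_log_gtn (isT : 1 < 2)%N D1.
have : (0 < up_log 2 D)%N by rewrite up_log_gt0.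
by case: (up_log 2 D) => // k _ /=; rewrite expnS; lia.
Qed.

Lemma tau_large D : (0 < D)%N ->
  D%:R * expR (- (7 + up_log 2 D)%:R) <= 1 / 100 :> R.
Proof.
move=> D0; rewrite expRN ler_pdivrMr ?expR_gt0 //.
have := expR_ge_exp2 (7 + up_log 2 D).
rewrite exprD (_ : 2 ^+ 7 = 128); last by rewrite -natrX.
have : D%:R <= 2 ^+ up_log 2 D :> R by rewrite -natrX ler_nat up_logP.
have : 0 <= D%:R :> R by [].
lra.
Qed.

(** The left side is at most [257 D ^ 2 exp (- X)], while [D ^ 2 <= 4 ^ d n ^ 2] and
    [exp X >= 2 ^ 12 4 ^ d n ^ 2]. *)
Lemma hits_likely_numeric (n d D : nat) (X : R) : (0 < n)%N -> (0 < D)%N ->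
  (D <= n * 2 ^ d)%N -> 12 + 2 * d%:R + 2 * ln n%:R <= X ->
  D%:R * ((2 ^+ (7 + up_log 2 D) + 1) * expR (- X)) <= 1 / 10 :> R.
Proof.
move=> n0 D0 DU XL.
have nR : 0 < n%:R :> R by rewrite ltr0n.
have e1 : 4096 * (4 ^+ d * n%:R ^+ 2) <= expR X :> R.
  apply: le_trans (_ : expR (12 + 2 * d%:R + 2 * ln n%:R) <= _); last by rewrite ler_expR.
  rewrite -addrA (expRD 12) (expRD (2 * d%:R)).
  have a1 : 4096 <= expR 12 :> R by apply: le_trans (expR_ge_exp2 12); rewrite -natrX.
  have a2 : 4 ^+ d <= expR (2 * d%:R) :> R.
    rewrite -natrM; apply: le_trans (expR_ge_exp2 (2 * d)).
    by rewrite exprM (_ : 2 ^+ 2 = 4 :> R) //; ring.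
  have a3 : n%:R ^+ 2 <= expR (2 * ln n%:R) :> R by rewrite expRM_natl lnK.
  have n2 : 0 <= n%:R ^+ 2 :> R by exact: sqr_ge0.
  have d4 : 0 <= 4 ^+ d :> R by exact: exprn_ge0.
  by apply: ler_pM => //; [exact: mulr_ge0|exact: ler_pM].
have tauU : 2 ^+ (7 + up_log 2 D) <= 256 * D%:R :> R.
  rewrite -!natrX -natrM ler_nat expnD.
  have := exp2_up_log_le D0; rewrite (_ : 2 ^ 7 = 128)%N //; lia.
have D2 : D%:R ^+ 2 <= 4 ^+ d * n%:R ^+ 2 :> R.
  rewrite -!natrX -natrM ler_nat (_ : 4 ^ d = (2 ^ d) ^ 2)%N; last by rewrite -expnAC.
  by rewrite -expnMn mulnC leq_exp2r.
have D1 : 1 <= D%:R :> R by rewrite ler1n.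
rewrite mulrA expRN ler_pdivrMr ?expR_gt0 //.
have : D%:R * (2 ^+ (7 + up_log 2 D) + 1) <= D%:R * (257 * D%:R) :> R.
  by apply: ler_wpM2l => //; lra.
have := sqr_ge0 (D%:R : R).
lra.
Qed.

End Thresholds.

Lemma sample_count (R : realType) (D : nat) (eps : R) (h := Num.sqrt D%:R : R) : 0 < eps ->
  exists m, [/\ forall j, (32 * 1000) ^+ 2 * D%:R <= (j%:R * (eps * eps)) ^+ 2
                  <-> (m <= j)%N,
    32 * 1000 * h <= m%:R * eps ^+ 2 & m%:R * eps ^+ 2 <= 32 * 1000 * h + eps ^+ 2].
Proof.
move=> eps0; pose e := eps * eps; have e0 : 0 < e by rewrite mulr_gt0.
pose p (j : nat) := 32 * 1000 * h <= j%:R * e.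
have h0 : 0 <= h by rewrite sqrtr_ge0.
have ex : exists j, p j.
  exists (Num.bound (32 * 1000 * h / e)); rewrite /p -ler_pdivrMr //.
  by apply/ltW/archi_boundP; rewrite divr_ge0 ?(ltW e0) //; lra.
case: (ex_minnP ex) => m pm mmin; exists m.
have mono j : p j <-> (m <= j)%N.
  split=> [/mmin //|mj]; apply: (le_trans pm); apply: ler_wpM2r; first exact: ltW.
  by rewrite ler_nat.
split=> [j||]; rewrite ?expr2 -/e //.
- rewrite -mono /p -{1}(sqr_sqrtr (ler0n R D)) -/h -!expr2 -exprMn ler_sqr // nnegrE.
    by lra.
  by rewrite mulr_ge0 // ltW.
- case: m pm mmin mono => [|m] pm mmin mono; first by rewrite mul0r; lra.
  rewrite -natr1 mulrDl mul1r lerD2r leNgt; apply/negP => lt.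
  have : p m by exact: ltW.
  by move=> /mono; rewrite ltnn.
Qed.

Lemma sample_scale_ge (R : realType) n (S : rel 'I_n) (eps : R) : 0 < eps ->
  Num.sqrt (table_size S)%:R / eps ^+ 2 <= sample_scale S eps.
Proof.
move=> eps0; rewrite /sample_scale; apply: ler_wpM2r.
  by rewrite invr_ge0 exprn_ge0 // ltW.
set a := 2 `^ _.
have a2 : a ^+ 2 = 2 ^+ max_indegree S.
  by rewrite /a -(powR_mulrn 2) ?powR_ge0 // -powRrM divfK ?pnatr_eq0 // powR_mulrn.
have a0 : 0 <= a := powR_ge0 _ _.
rewrite -[a]ger0_norm // -sqrtr_sqr -sqrtrM ?sqr_ge0 //.
apply: ler_wsqrtr; rewrite a2 -natrX -natrM ler_nat mulnC.
exact: table_size_le.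
Qed.

Lemma l1_dist_le2 (R : realType) n (P Q : cube n -> R) :
  is_distribution P -> is_distribution Q -> l1_dist P Q <= 2.
Proof.
move=> [P0 P1] [Q0 Q1].
apply: (@le_trans _ _ (\sum_x (P x + Q x))); last by rewrite big_split /= P1 Q1.
apply: ler_sum => x _; apply: (le_trans (ler_normB _ _)).
by rewrite !ger0_norm.
Qed.

(** * Consequences of balancedness *)

Section Regime.
Variables (R : realType) (n : nat) (S : rel 'I_n) (c C eps : R) (Q : cube n -> R).
Hypothesis n0 : (0 < n)%N.
Hypothesis QB : bayes_net S Q.
Hypothesis Q_balanced : balanced S c C Q.
Hypothesis c_large : log_factor (2 * 1000) 1 n / Num.sqrt n%:R <= c.
Hypothesis C_large :
  log_factor (2 * 1000) 1 n * ((max_indegree S)%:R * eps ^+ 2 / Num.sqrt n%:R) <= C.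

Let lg := 1 + ln n%:R : R.
Let sn := Num.sqrt n%:R : R.

Lemma config_balanced g :
  c <= param Q g <= 1 - c /\ C <= hit_prob (@pos n S) (@owner n S) Q g.
Proof.
have sz : size (config g) == #|parents S (owner g)| by rewrite size_config.
by rewrite hit_probE; exact: (Q_balanced (Tuple sz)).
Qed.

Lemma table_size_gt0 : (0 < table_size S)%N.
Proof. by apply: leq_trans n0 (table_size_ge S). Qed.

Lemma log_ge1 : 1 <= lg.
Proof. by rewrite /lg lerDl ln_ge0 // ler1n. Qed.

Lemma sqrt_node_ge1 : 1 <= sn.
Proof. by rewrite -sqrtr1; apply: ler_wsqrtr; rewrite ler1n. Qed.

Lemma c_ge : 2 * 1000 * lg <= c * sn.
Proof.
have sn1 := sqrt_node_ge1.
have sn0 : 0 < sn by apply: lt_le_trans sn1.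
by have := c_large; rewrite /log_factor expr1 -/lg -/sn ler_pdivrMr.
Qed.

(** The upper bound holds because some configuration exists, so [[c, 1 - c]] is nonempty. *)
Lemma c_itv : 0 < c <= 1 / 2.
Proof.
have sn1 := sqrt_node_ge1; have lg1 := log_ge1; have cg := c_ge.
have [/andP[c1 c2] _] := config_balanced (Ordinal table_size_gt0).
have sn0 : 0 < sn by lra.
apply/andP; split; last by lra.
by rewrite -(pmulr_lgt0 _ sn0); lra.
Qed.

Lemma param_itv (g : 'I_(table_size S)) : 0 < param Q g < 1.
Proof.
have [/andP[c1 c2] _] := config_balanced g; have /andP[c3 c4] := c_itv.
by apply/andP; split; lra.
Qed.

Lemma sqrt_table_ge : sn <= Num.sqrt (table_size S)%:R.
Proof. by apply: ler_wsqrtr; rewrite ler_nat table_size_ge. Qed.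

(** One of [q], [1 - q] is at least [1 / 2], so the variance is at least [c / 2 >= 1000 / sqrt n],
    and [n <= D]. *)
Lemma param_variance (g : 'I_(table_size S)) :
  (param Q g * (1 - param Q g))^-1 <= Num.sqrt (table_size S)%:R / 1000.
Proof.
have [/andP[q1 q2] _] := config_balanced g; have /andP[c1 c2] := c_itv.
have /andP[q3 q4] := param_itv g.
set q := param Q g in q1 q2 q3 q4 *.
have qc : c / 2 <= q * (1 - q) by nra.
have sn1 := sqrt_node_ge1; have lg1 := log_ge1; have cg := c_ge.
have c20 : 0 < c / 2 by lra.
apply: (@le_trans _ _ (c / 2)^-1).
  by rewrite lef_pV2 ?posrE //; apply: lt_le_trans qc.
apply: (@le_trans _ _ (sn / 1000)); last by have := sqrt_table_ge; lra.
rewrite -[leLHS]mul1r ler_pdivrMr //; lra.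
Qed.

Variable m : nat.
Hypothesis eps_itv : 0 < eps <= 2.
Hypothesis m_large : 32 * 1000 * Num.sqrt (table_size S)%:R <= m%:R * eps ^+ 2.

(** For in-degree 0 the bound on [C] is void, but each configuration then has probability 1 and [m]
    is large: [c <= 1 / 2] forces [sqrt n] to exceed a multiple of the logarithm. Otherwise
    [m eps ^ 2 >= sqrt n] turns the bound on [C] into [m C >= 2000 d (1 + ln n)]. *)
Lemma expected_hits_ge g :
  24 + 4 * (max_indegree S)%:R + 4 * ln n%:R <=
  m%:R * hit_prob (@pos n S) (@owner n S) Q g.
Proof.
have sn1 := sqrt_node_ge1; have lg1 := log_ge1; have cg := c_ge.
have /andP[c1 c2] := c_itv; have /andP[e0 e2] := eps_itv.
have sn0 : 0 < sn by lra.
have mL := m_large; have sT := sqrt_table_ge.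
have lnE : ln n%:R = lg - 1 by rewrite /lg; lra.
have [d0|d1] := posnP (max_indegree S).
  have -> : hit_prob (@pos n S) (@owner n S) Q g = 1.
    rewrite hit_probE; case: QB => -[_ <-] _; apply: eq_bigl => x.
    have p0 : #|parents S (owner g)| = 0%N.
      by apply/eqP; rewrite -leqn0 -d0; exact: leq_bigmax.
    have c0 : config g = [::] by apply/size0nil; rewrite size_config.
    rewrite /parent_config c0; apply/eqP/size0nil.
    by rewrite size_parent_values.
  rewrite d0 mulr1 lnE.
  have : m%:R * eps ^+ 2 <= m%:R * 4 :> R.
    by apply: ler_wpM2l => //; nra.
  have : c * sn <= 1 / 2 * sn by apply: ler_wpM2r => //; exact: ltW.
  lra.
set d := max_indegree S in d1 *.
have dR : 1 <= d%:R :> R by rewrite ler1n.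
have [_ Cg] := config_balanced g.
apply: (@le_trans _ _ (m%:R * C)); last by apply: ler_wpM2l.
apply: (@le_trans _ _ (2 * 1000 * (lg * d%:R))).
  rewrite lnE.
  have : d%:R <= lg * d%:R by rewrite ler_peMl // ler0n.
  have : lg <= lg * d%:R by rewrite ler_peMr //; lra.
  lra.
have := ler_wpM2l (ler0n R m) C_large; apply: le_trans.
rewrite /log_factor expr1 -/lg -/sn -/d.
have -> : m%:R * (2 * 1000 * lg * (d%:R * eps ^+ 2 / sn)) =
    2 * 1000 * (lg * d%:R) * (m%:R * eps ^+ 2 / sn) by ring.
rewrite ler_peMr //.
  by apply: mulr_ge0 => //; apply: mulr_ge0 => //; lra.
by rewrite ler_pdivlMr // mul1r; lra.
Qed.

End Regime.

Theorem theorem5p2 (R : realType) :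
  exists (tester : cmd) (A K B : R) (k e : nat),
    [/\ 0 < A, 0 < K & 0 < B] /\
    forall (n : nat) (S : rel 'I_n) (c C eps : R) (Q : cube n -> R),
      topsorted S ->
      bayes_net S Q ->
      balanced S c C Q ->
      log_factor A k n / Num.sqrt n%:R <= c ->
      log_factor A k n * ((max_indegree S)%:R * eps ^+ 2 / Num.sqrt n%:R) <= C ->
      0 < eps ->
      exists m t : nat,
        [/\ m%:R <= K * sample_scale S eps,
            t%:R <= B * (1 + (input_size (tester_input S Q eps))%:R
                           + sample_scale S eps) ^+ e,
            halts_within n tester (tester_input S Q eps) m t
          & forall P : cube n -> R, bayes_net S P ->
              (P = Q ->
                 2 / 3 <= answer_prob tester (tester_input S Q eps) P m t true) /\
              (eps < l1_dist P Q ->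
                 2 / 3 <= answer_prob tester (tester_input S Q eps) P m t false)].
Proof.
pose K1 : R := 32 * 1000 + 5.
have K10 : 0 < K1 by rewrite /K1; lra.
(* [K1] adds to the factor of [m_loop] a margin for rounding up, since [eps ^ 2 <= 4 <= 4 sqrt D];
   the two batches total [4 m] samples, and the cubic running time contributes [K1 ^ 3]. *)
exists tester, (2 * 1000), (4 * K1), (1000 * K1 ^+ 3), 1%N, 3.
split; first by split; rewrite ?mulr_gt0 ?exprn_gt0 //; lra.
move=> n S c C eps Q top QB bal cL CL eps0.
have scale0 : 0 <= sample_scale S eps.
  by rewrite /sample_scale !mulr_ge0 ?powR_ge0 ?sqrtr_ge0 // invr_ge0 exprn_ge0 // ltW.
set inp := tester_input S Q eps.
pose base := 1 + (input_size inp)%:R + sample_scale S eps.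
have base1 : 1 <= base by rewrite /base -addrA lerDl addr_ge0.
(* Otherwise no [P] is far from [Q]: distances are at most 2, and for [n = 0] the cube is a point.
   Accepting without samples respects the sample bound, which may be below 1 there. *)
have [small|big] := boolP ((0 < n)%N && (eps <= 2)); last first.
  have fast smp coin : runs smp coin tester (init inp) 2 (fun s => drawn s = 0%N /\ nmem s 2 0 = 1%N).
    apply: (@runs_if _ _ _ _ _ _ _ 1); rewrite [beval _ _]/=.
    by rewrite (negbTE big); apply: runs_straight.
  exists 0%N, 2; split.
  - by rewrite mulr_ge0 // mulr_ge0 // ltW.
  - have b3 : 1 <= base ^+ 3 by rewrite exprn_ege1.
    have k3 : 1 <= K1 ^+ 3 by rewrite exprn_ege1 // /K1; lra.
    apply: (@le_trans _ _ (1000 * K1 ^+ 3)); first by lra.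
    by rewrite ler_peMr // mulr_ge0 // exprn_ge0 // ltW.
  - move=> smp coin; rewrite /halts_within.
    by have [s' -> [->]] := runs_run (fast (fun j => sample_bits (smp j)) coin) (leqnn 2).
  move=> P PB.
  have dec (w : {ffun 'I_0 -> cube n}) coin :
      accepts tester inp (stream [::] (fun j => sample_bits (w j))) coin 2 = true.
    set smp := stream _ _; rewrite /accepts.
    by have [s' -> [_ /= ->]] := runs_run (fast smp coin) (leqnn 2).
  split=> [_|far].
    rewrite (answer_probE (dec := xpredT) P true dec) /=; lra.
  exfalso; move: big; rewrite negb_and -leqNgt leqn0 -ltNge => /orP[/eqP n0|e2].
    have pE (P' : cube n -> R) : bayes_net S P' -> forall x, P' x = 1.
      move=> P'B x; rewrite (bayes_net_prod top P'B) big1 // => i _.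
      by have := ltn_ord i; rewrite {2}n0.
    move: far; rewrite /l1_dist big1 => [|x _]; first by move=> ?; lra.
    by rewrite (pE _ PB) (pE _ QB) subrr normr0.
  have := l1_dist_le2 (proj1 PB) (proj1 QB); lra.
case/andP: small => n0 e2.
have [m [mP mL mU]] := sample_count (table_size S) eps0.
set h := Num.sqrt _ in mL mU.
have h1 : 1 <= h.
  by rewrite -sqrtr1; apply: ler_wsqrtr; rewrite ler1n table_size_gt0.
have hG : h ^+ 2 = #|'I_(table_size S)|%:R by rewrite sqr_sqrtr // card_ord.
pose t := up_log 2 (table_size S).
have D0 := table_size_gt0 S n0.
have tlt j : (j < t)%N -> (2 ^ j < offset n (nat_adj S) n)%N.
  by rewrite ltnNge => jt; rewrite ltnNge; apply: contra jt; exact: up_log_min.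
have tge : (offset n (nat_adj S) n <= 2 ^ t)%N by exact: up_logP.
have main smp coin (sz : forall k, (k < m + 3 * m)%N -> size (smp k) = n) :
    runs smp coin tester (init inp) (main_cost n (nat_adj S) m t).+1 (fun s' =>
      drawn s' = (m + 3 * m)%N /\
      nmem s' 2 0 = verdict smp n (nat_adj S) (rmem (init inp) 1) eps m (7 + t)).
  apply: runs_if; rewrite [beval _ _]/= n0 e2.
  apply: tester_main_runs => //.
  - exact: input_graph.
  - by move=> j; rewrite /= nth_nil.
  - by move=> g; rewrite /cell_at /= nth_nil.
exists (m + 3 * m)%N, (main_cost n (nat_adj S) m t).+1.
have e20 : 0 < eps ^+ 2 by rewrite exprn_gt0.
have e24 : eps ^+ 2 <= 4 by rewrite expr2; nra.
have scaleL : h <= sample_scale S eps * eps ^+ 2.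
  by rewrite -ler_pdivrMr // sample_scale_ge.
have mK : m%:R <= K1 * sample_scale S eps.
  rewrite -(ler_pM2r e20); apply: (le_trans mU).
  by rewrite -mulrA /K1; lra.
split.
- by rewrite natrD natrM; lra.
- have tD : (t <= offset n (nat_adj S) n)%N.
    by apply: up_log_min => //; apply: ltnW; exact: ltn_expl.
  apply: (@le_trans _ _ (1000 * (1 + n + table_size S + m) ^ 3)%:R).
    by rewrite ler_nat; exact: main_cost_le tD.
  rewrite natrM natrX -mulrA -exprMn; apply: ler_wpM2l => //.
  apply: lerXn2r; rewrite ?nnegrE //.
    by rewrite mulr_ge0 ?(ltW K10) // (le_trans _ base1).
  rewrite -/base 3!natrD.
  have sz : 1 + n%:R + (table_size S)%:R <= (input_size inp)%:R :> R.
    by have := input_size_ge S Q eps; rewrite -(ler_nat R) !natrD.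
  have : K1 * base = K1 * (1 + (input_size inp)%:R) + K1 * sample_scale S eps.
    by rewrite /base mulrDr.
  have : 1 + (input_size inp)%:R <= K1 * (1 + (input_size inp)%:R).
    by rewrite ler_peMl ?addr_ge0 // /K1; lra.
  lra.
- move=> smp coin; have sz k : (k < m + 3 * m)%N -> size (sample_bits (smp k)) = n.
    by rewrite size_sample_bits.
  by have [s' -> [-> _]] := runs_run (main (fun j => sample_bits (smp j)) coin sz) (leqnn _).
pose dec (ws : seq (cube n)) :=
  decide (@pos n S) (@owner n S) (param Q) m (7 + t) eps (take m ws) (drop m ws).
have decE (w : {ffun 'I_(m + 3 * m) -> cube n}) coin :
    accepts tester inp (stream [::] (fun j => sample_bits (w j))) coin
      (main_cost n (nat_adj S) m t).+1 = dec (codom w).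
  set smp := stream _ _.
  have smpE k : (k < m + 3 * m)%N -> smp k = nth [::] [seq sample_bits x | x <- codom w] k.
    move=> km; pose i := Ordinal km; rewrite /smp /stream -[k]/(val i) valK.
    rewrite (nth_map (w i)) ?size_codom ?card_ord // (nth_map i) ?size_enum_ord //.
    by rewrite nth_ord_enum.
  have sz k : (k < m + 3 * m)%N -> size (smp k) = n.
    move=> km; rewrite smpE // (nth_map [ffun=> false]) ?size_sample_bits //.
    by rewrite size_codom card_ord.
  rewrite /accepts; have [s' -> [_ /= ->]] := runs_run (main smp coin sz) (leqnn _).
  have szw : size (codom w) = (m + 3 * m)%N by rewrite size_codom card_ord.
  rewrite eqb0 negbK (verdict_decide _ _ _ _ szw smpE).
  rewrite /dec /decide; congr (_ && (64 * _ <= _)).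
  by apply: eq_bigr => g _; rewrite /= table_nth.
have eI : 0 < eps <= 2 by rewrite eps0.
have q01 := param_itv n0 bal cL.
have qV := param_variance n0 bal cL.
have QF := bayes_net_factorizes top QB.
pose acc := decide (@pos n S) (@owner n S) (param Q) m (7 + t) eps.
have split (P : cube n -> R) b : iidE P (m + 3 * m) (fun ws => (dec ws == b)%:R) =
    iidE P m (fun s1 => iidE P (3 * m) (fun s2 => (acc s1 s2 == b)%:R)).
  rewrite iidE_cat; apply: eq_iidE => s1 z1; apply: eq_iidE => s2 z2.
  by rewrite /dec (take_size_cat _ z1) (drop_size_cat _ z1).
have neg (P : cube n -> R) (p : 'I_(table_size S) -> R) b :
    factorizes (@pos n S) P p ->
    iidE P (m + 3 * m) (fun ws => (dec ws == b)%:R) =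
    1 - iidE P (m + 3 * m) (fun ws => (dec ws == ~~ b)%:R).
  move=> PF; have P1 := factorizes_sum (@pos_prefix n S top) PF.
  apply/eqP; rewrite eq_sym subr_eq eq_sym -iidED -[X in _ == X](iidE_cst (m + 3 * m) 1 P1).
  apply/eqP/eq_iidE => ws _; by case: (dec ws); case: b; rewrite /= ?addr0 ?add0r.
move=> P PB; have PF := bayes_net_factorizes top PB; split=> [PQ|far].
- have : iidE Q m (fun s1 => iidE Q (3 * m) (fun s2 => (~~ acc s1 s2)%:R)) <= 1 / 3.
    apply: (reject_prob_le (@owner_pos n S) (@pos_prefix n S top) h1 hG q01 qV mL _ QF) => //.
    move=> g; rewrite card_ord.
    apply: (hits_likely_numeric (n := n) (d := max_indegree S)) => //.
      exact: table_size_le.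
    by have := expected_hits_ge n0 QB bal cL CL eI mL g; lra.
  rewrite (answer_probE _ _ decE) (neg _ _ _ PF) split PQ.
  rewrite (eq_iidE (g := fun s1 => iidE Q (3 * m) (fun s2 => (~~ acc s1 s2)%:R))) => [|s1 _].
    by lra.
  by apply: eq_iidE => s2 _; rewrite /= eqbF_neg.
- have : iidE P m (fun s1 => iidE P (3 * m) (fun s2 => (acc s1 s2)%:R)) <= 1 / 3.
    apply: (accept_prob_le (@owner_pos n S) (@pos_prefix n S top) h1 hG q01 qV mL _ PF QF _
      eps0 far) => //.
      by move=> g b; exact: param_marginal.
    by rewrite card_ord; exact: tau_large.
  rewrite (answer_probE _ _ decE) (neg _ _ _ PF) split.
  rewrite (eq_iidE (g := fun s1 => iidE P (3 * m) (fun s2 => (acc s1 s2)%:R))) => [|s1 _].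
    by lra.
  by apply: eq_iidE => s2 _; rewrite /= eqb_id.
Qed.
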